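(* Let $D\ge 32$ be a power of $2$ and let $\mathcal{A}$ be a quantum algorithm making at most $q$ queries to its oracle. Then \[\mathsf{Adv}^{\mathsf{1LD}}_{D,3D^2}(\mathcal{A})\le 11\sqrt[6]{(q\cdot\lg D\cdot\lg\lg D)^3/D^2}.\]
   Context: $[n]=\{1,\dots,n\}$ and $\lg$ is the base-2 logarithm. An instance is a function $L:[D]\to[R]$, accessed via the quantum oracle $|x,y\rangle\mapsto|x,y\oplus L(x)\rangle$. It is viewed as two lists $L_b(x)=L(x+bD/2)$ for $b\in\{0,1\}$ and $x\in[D/2]$. The list disjointness problem $\mathsf{1LD}$ has: - instance set: those $L$ with $L_0,L_1$ each injective and with images sharing at most one element; - language: exactly one common element. $\mathsf{Adv}^{\mathsf{1LD}}_{D,R}(\mathcal{A})=\min_{L\in\text{language}}\Pr[\mathcal{A}[L]=1]-\max_{L\in\text{instances}\setminus\text{language}}\Pr[\mathcal{A}[L]=1]$. *)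

(* Defs.v *)
From HB Require Import structures.
From mathcomp Require Import all_boot all_order all_algebra.
From mathcomp Require Import complex.
From mathcomp Require Import reals exp.
From Stdlib Require PeanoNat.

Set Implicit Arguments.
Unset Strict Implicit.
Unset Printing Implicit Defensive.

Import Order.TTheory GRing.Theory Num.Theory.
Local Open Scope ring_scope.

Definition lg {R : realType} (x : R) : R := ln x / ln 2.

Lemma pow2_gt0 (m : nat) : (0 < 2 ^ m)%N.
Proof. by rewrite expn_gt0. Qed.

Definition xorI (m : nat) (y : 'I_(2 ^ m)) (v : nat) : 'I_(2 ^ m) :=
  Ordinal (ltn_pmod (PeanoNat.Nat.lxor y v) (pow2_gt0 m)).
(* When v < 2^m, Nat.lxor y v < 2^m already, so the "mod" is the identity. *)

(* Basis of the Hilbert space: |x, y, w> with x in 'I_D (query index),  *)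
(* y in 'I_(2^m) (answer register, m qubits) and w in 'I_W (workspace). *)
Definition space (D m W : nat) : finType := ('I_D * 'I_(2 ^ m) * 'I_W)%type.

Definition applyU {R : realType} {S : finType}
    (U : {ffun S * S -> R[i]}) (psi : {ffun S -> R[i]}) : {ffun S -> R[i]} :=
  [ffun s => \sum_(t : S) U (s, t) * psi t].

Definition unitary {R : realType} {S : finType} (U : {ffun S * S -> R[i]}) : Prop :=
  forall s t : S, \sum_(k : S) (conjc (U (k, s))) * U (k, t) = (s == t)%:R.

(* the oracle |x, y, w> |-> |x, y xor L(x), w> *)
Definition oracle {R : realType} {D Rg m W : nat} (L : {ffun 'I_D -> 'I_Rg})
    (psi : {ffun space D m W -> R[i]}) : {ffun space D m W -> R[i]} :=
  [ffun s => psi (s.1.1, xorI s.1.2 (L s.1.1), s.2)].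

(* A quantum query algorithm with oracle access to L : [D] -> [Rg]:
   m answer qubits (with Rg <= 2^m), W-dimensional workspace, T queries,
   unitaries U_0, ..., U_T, initial basis state s0, and final
   computational-basis measurement, outputting 1 iff the outcome is in acc. *)
Record qalg (R : realType) (D Rg : nat) : Type := QAlg {
  qa_m : nat;
  qa_W : nat;
  qa_T : nat;
  qa_U : nat -> {ffun space D qa_m qa_W * space D qa_m qa_W -> R[i]};
  qa_unitary : forall k, unitary (qa_U k);
  qa_init : space D qa_m qa_W;
  qa_acc : {set space D qa_m qa_W};
  qa_range : (Rg <= 2 ^ qa_m)%N
}.

Definition basis_state {R : realType} {S : finType} (s0 : S) : {ffun S -> R[i]} :=
  [ffun s => (s == s0)%:R].

Fixpoint qa_run {R : realType} {D Rg : nat} (A : qalg R D Rg)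
    (L : {ffun 'I_D -> 'I_Rg}) (k : nat) : {ffun space D (qa_m A) (qa_W A) -> R[i]} :=
  match k with
  | 0 => applyU (qa_U A 0) (basis_state (qa_init A))
  | k'.+1 => applyU (qa_U A k'.+1) (oracle L (qa_run A L k'))
  end.

Definition sqnorm {R : realType} (z : R[i]) : R := (complex.Re z) ^+ 2 + (complex.Im z) ^+ 2.

Definition acc_prob {R : realType} {D Rg : nat} (A : qalg R D Rg)
    (L : {ffun 'I_D -> 'I_Rg}) : R :=
  \sum_(s in qa_acc A) sqnorm (qa_run A L (qa_T A) s).

(* List disjointness 1LD. L is viewed as L_0(x) = L(x), L_1(x) = L(x + D/2)
   for x < D/2 (0-indexed version of the paper's convention).           *)
Definition img0 {D Rg : nat} (L : {ffun 'I_D -> 'I_Rg}) : {set 'I_Rg} :=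
  [set L x | x : 'I_D & (x < D %/ 2)%N].
Definition img1 {D Rg : nat} (L : {ffun 'I_D -> 'I_Rg}) : {set 'I_Rg} :=
  [set L x | x : 'I_D & (D %/ 2 <= x)%N].

Definition halves_injective {D Rg : nat} (L : {ffun 'I_D -> 'I_Rg}) : bool :=
  [forall x : 'I_D, forall y : 'I_D,
     ((((x < D %/ 2) && (y < D %/ 2)) || ((D %/ 2 <= x) && (D %/ 2 <= y)))
        && (L x == L y)) ==> (x == y)]%N.

Definition LD1_instance {D Rg : nat} (L : {ffun 'I_D -> 'I_Rg}) : bool :=
  halves_injective L && (#|img0 L :&: img1 L| <= 1)%N.

Definition LD1_language {D Rg : nat} (L : {ffun 'I_D -> 'I_Rg}) : bool :=
  halves_injective L && (#|img0 L :&: img1 L| == 1)%N.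

(* Adv = min_{L in language} Pr[A[L]=1] - max_{L in instances \ language} Pr[A[L]=1].
   The neutral elements 1 (for min) and 0 (for max) do not affect the value
   since probabilities lie in [0,1] and both sets are nonempty here. *)
Definition adv_1LD {R : realType} {D Rg : nat} (A : qalg R D Rg) : R :=
  \big[Order.min/1]_(L : {ffun 'I_D -> 'I_Rg} | LD1_language L) acc_prob A L
  - \big[Order.max/0]_(L : {ffun 'I_D -> 'I_Rg} | LD1_instance L && ~~ LD1_language L)
      acc_prob A L.

(* Main.v *)
(** The proof is by the general (negative-weight) adversary method, with an
    adversary matrix in the style of Belovs and Spalek.  Let [avg i] average a
    function of the input [F] over its [i]-th value.  With
    [damp i = r + (1 - r) avg i] and [noise] the product of all [damp i], the
    rows of the matrix indexed by inputs colliding at [(a, b)] are those of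
    [noise (avg a + avg b - avg a avg b)], so nothing is learnt from looking at
    only one of [a], [b].  A query at [x] only sees the part of the matrix that
    changes the value at [x]; its norm is small because [1 - r] is small when
    [x] is not in [{a, b}], and by a telescoping sum over the factors of [noise]
    when [x] is [a] or [b].  Taking [1 - r = D^(-2/3)] balances the two.  With
    range [3 D^2] a random input is injective with probability at least [5/6],
    so restricting the matrix to legal inputs costs only a constant factor, and
    one obtains [Adv^2 <= 32 T / D^(2/3)] for [T] queries. *)

Require Import Defs.
From HB Require Import structures.
From mathcomp Require Import all_boot all_order all_algebra.
From mathcomp Require Import complex.
From mathcomp Require Import reals exp.
From mathcomp Require Import ring lra.
From Stdlib Require PeanoNat.
Import Order.TTheory GRing.Theory Num.Theory.
Local Open Scope ring_scope.

Set Implicit Arguments.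
Unset Strict Implicit.
Unset Printing Implicit Defensive.

(** * Bilinear forms and weighted families of states *)

Section BilinearForms.
Variables (R : realType) (S : finType).
Implicit Types (f g : S -> R) (G : S -> S -> R).

(** The squared Euclidean norm; norms appear below as [Num.sqrt (l2 f)]. *)
Definition l2 f : R := \sum_F f F ^+ 2.

Definition bform G g f : R := \sum_F' \sum_F G F' F * g F' * f F.

Definition vanishes_off (P : pred S) f := forall F, ~~ P F -> f F = 0.

Lemma l2_ge0 f : 0 <= l2 f.
Proof. by apply: sumr_ge0 => F _; apply: sqr_ge0. Qed.

Lemma l2Z c f : l2 (fun F => c * f F) = c ^+ 2 * l2 f.
Proof. by rewrite /l2 mulr_sumr; apply: eq_bigr => F _; rewrite exprMn. Qed.

Lemma bformZ G c d g f :
  bform G (fun F => c * g F) (fun F => d * f F) = c * d * bform G g f.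
Proof.
rewrite /bform mulr_sumr; apply: eq_bigr => F' _.
by rewrite mulr_sumr; apply: eq_bigr => F _; ring.
Qed.

(** Lagrange's identity: the non-negative sum of all [(a i * b j - a j * b i) ^+ 2] is twice the
    difference of the two sides. *)
Lemma cauchy_schwarz (I : finType) (P : pred I) (a b : I -> R) :
  (\sum_(i | P i) a i * b i) ^+ 2
    <= (\sum_(i | P i) a i ^+ 2) * (\sum_(i | P i) b i ^+ 2).
Proof.
have H : 0 <= \sum_(i | P i) \sum_(j | P j) (a i * b j - a j * b i) ^+ 2.
  by apply: sumr_ge0 => i _; apply: sumr_ge0 => j _; apply: sqr_ge0.
suff E : \sum_(i | P i) \sum_(j | P j) (a i * b j - a j * b i) ^+ 2 =
   2 * ((\sum_(i | P i) a i ^+ 2) * (\sum_(i | P i) b i ^+ 2)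
        - (\sum_(i | P i) a i * b i) ^+ 2).
  by move: H; rewrite E pmulr_rge0 // subr_ge0.
have E1 : \sum_(i | P i) \sum_(j | P j) a i ^+ 2 * b j ^+ 2 =
   (\sum_(i | P i) a i ^+ 2) * (\sum_(i | P i) b i ^+ 2).
  by rewrite mulr_suml; apply: eq_bigr => i _; rewrite mulr_sumr.
have E2 : \sum_(i | P i) \sum_(j | P j) a j ^+ 2 * b i ^+ 2 =
   (\sum_(i | P i) a i ^+ 2) * (\sum_(i | P i) b i ^+ 2).
  by rewrite exchange_big /= E1.
have E3 : \sum_(i | P i) \sum_(j | P j) (a i * b i) * (a j * b j) =
   (\sum_(i | P i) a i * b i) ^+ 2.
  by rewrite expr2 mulr_suml; apply: eq_bigr => i _; rewrite mulr_sumr.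
rewrite mulrBr -E3 mulr_natl mulr2n -{1}E1 -E2 -!big_split /= mulr_sumr.
rewrite -sumrB; apply: eq_bigr => i _.
rewrite -!big_split /= mulr_sumr -sumrB; apply: eq_bigr => j _; ring.
Qed.

(* The norm of [G] as a form on functions supported in [yes] and [no], together
   with approximate maximisers: no compactness is needed. *)
Lemma bform_norm G (yes no : pred S) g0 f0 :
  vanishes_off yes g0 -> vanishes_off no f0 -> 0 < l2 g0 -> 0 < l2 f0 ->
  exists c,
    (forall g f, vanishes_off yes g -> vanishes_off no f ->
       bform G g f <= c * (Num.sqrt (l2 g) * Num.sqrt (l2 f))) /\
    (forall eps, 0 < eps -> exists v u,
       [/\ vanishes_off yes v, vanishes_off no u, l2 v = 1, l2 u = 1
         & c - eps < bform G v u]).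
Proof.
move=> sg0 sf0 g0_gt0 f0_gt0.
(* Values at unit vectors with the required supports; the norm [c] is their supremum. *)
pose E : classical_sets.set R := fun z => exists v u,
  [/\ vanishes_off yes v, vanishes_off no u, l2 v = 1, l2 u = 1
    & z = bform G v u].
have normalize f : 0 < l2 f -> l2 (fun F => (Num.sqrt (l2 f))^-1 * f F) = 1.
  move=> f_gt0; rewrite l2Z exprVn sqr_sqrtr ?ltW // mulVf //.
  by rewrite gt_eqF.
have vanZ P c f : vanishes_off P f -> vanishes_off P (fun F => c * f F).
  by move=> H F nP; rewrite H ?mulr0.
have le1 f : l2 f = 1 -> forall F, `|f F| <= 1.
  move=> f1 F; rewrite -(@ler_pXn2r _ 2) ?nnegrE // expr1n real_normK ?num_real //.
  rewrite -f1 /l2 (bigD1 F) //= lerDl.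
  by apply: sumr_ge0 => i _; apply: sqr_ge0.
have supE : classical_sets.has_sup E.
  split.
    by eexists; eexists; eexists; split; last reflexivity;
       [exact: (vanZ _ (Num.sqrt (l2 g0))^-1 _ sg0)
       |exact: (vanZ _ (Num.sqrt (l2 f0))^-1 _ sf0)| exact: normalize
       |exact: normalize].
  exists (\sum_F' \sum_F `|G F' F|) => _ [v [u [_ _ v1 u1 ->]]].
  apply: ler_sum => F' _; apply: ler_sum => F _.
  apply: (le_trans (ler_norm _)); rewrite !normrM -mulrA ler_piMr //.
  by rewrite mulr_ile1 ?le1.
exists (sup E); split => [g f sg sf|eps eps_gt0]; last first.
  have [_ [v [u [sv su v1 u1 ->]]] lt] := sup_adherent eps_gt0 supE.
  by exists v, u.
(* A function of norm zero cannot be normalised, but it vanishes everywhere and so does the form. *)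
have null h : l2 h = 0 -> forall F, h F = 0.
  move=> h0 F; apply/eqP; rewrite -sqrf_eq0.
  have /allP H := (etrans (esym (psumr_eq0 _ (fun i _ => sqr_ge0 (h i)))) (introT eqP h0)).
  by apply: H; rewrite mem_index_enum.
have [g_gt0|] := ltP 0 (l2 g); last first.
  move=> g0'; have {}g0' : l2 g = 0 by apply/eqP; rewrite eq_le g0' l2_ge0.
  rewrite g0' sqrtr0 mul0r mulr0 /bform big1 // => F' _.
  by rewrite big1 // => F _; rewrite (null g) // mulr0 mul0r.
have [f_gt0|] := ltP 0 (l2 f); last first.
  move=> f0'; have {}f0' : l2 f = 0 by apply/eqP; rewrite eq_le f0' l2_ge0.
  rewrite f0' sqrtr0 !mulr0 /bform big1 // => F' _.
  by rewrite big1 // => F _; rewrite (null f) // mulr0.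
have /(_ _)/= := sup_upper_bound supE.
move=> /(_ (bform G (fun F => (Num.sqrt (l2 g))^-1 * g F)
                    (fun F => (Num.sqrt (l2 f))^-1 * f F))) H.
have {}H : bform G (fun F => (Num.sqrt (l2 g))^-1 * g F)
                    (fun F => (Num.sqrt (l2 f))^-1 * f F) <= sup E.
  apply: H; eexists; eexists; split; last reflexivity.
  - exact: vanZ. - exact: vanZ. - exact: normalize. - exact: normalize.
move: H; rewrite bformZ -invfM mulrC ler_pdivrMr //.
by rewrite mulr_gt0 // sqrtr_gt0.
Qed.

End BilinearForms.

Section WeightedStates.
Variables (R : realType) (S J : finType).
Implicit Types (G : S -> S -> R) (u v : S -> R) (chi : S -> J -> R).

(** With [chi F] the state on input [F], this is the adversary progress measure: inner products of
    states weighted by [G], [v] and [u], restricted to the basis coordinates in [P]. *)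
Definition progress G v u (P : pred J) chi : R :=
  \sum_F' \sum_F G F' F * v F' * u F * \sum_(p | P p) chi F' p * chi F p.

Lemma progress_bform G v u P chi :
  progress G v u P chi =
  \sum_(p | P p) bform G (fun F => v F * chi F p) (fun F => u F * chi F p).
Proof.
rewrite /progress /bform [RHS]exchange_big /=; apply: eq_bigr => F' _.
rewrite [RHS]exchange_big /=; apply: eq_bigr => F _.
by rewrite mulr_sumr; apply: eq_bigr => p _; ring.
Qed.

Lemma sum_l2 u P chi :
  \sum_(p | P p) l2 (fun F => u F * chi F p)
    = \sum_F u F ^+ 2 * \sum_(p | P p) chi F p ^+ 2.
Proof.
rewrite exchange_big /=; apply: eq_bigr => F _.
by rewrite mulr_sumr; apply: eq_bigr => p _; rewrite exprMn.
Qed.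

(** Each coordinate [p] contributes one value of the form, at vectors with the supports of [v] and
    [u]; Cauchy-Schwarz over [p] combines the norms. *)
Lemma progress_le G c v u (yes no : pred S) P chi :
  vanishes_off yes v -> vanishes_off no u -> 0 <= c ->
  (forall g f, vanishes_off yes g -> vanishes_off no f ->
     bform G g f <= c * (Num.sqrt (l2 g) * Num.sqrt (l2 f))) ->
  progress G v u P chi <=
  c * Num.sqrt ((\sum_F v F ^+ 2 * \sum_(p | P p) chi F p ^+ 2) *
                (\sum_F u F ^+ 2 * \sum_(p | P p) chi F p ^+ 2)).
Proof.
move=> sv su c_ge0 H; rewrite progress_bform.
apply: (@le_trans _ _ (\sum_(p | P p) c * (Num.sqrt (l2 (fun F => v F * chi F p)) *
   Num.sqrt (l2 (fun F => u F * chi F p))))).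
  apply: ler_sum => p _; apply: H => F nF; first by rewrite sv ?mul0r.
  by rewrite su ?mul0r.
rewrite -mulr_sumr ler_wpM2l //; apply: (le_trans (ler_norm _)).
rewrite -sqrtr_sqr; apply: ler_wsqrtr.
apply: (le_trans (cauchy_schwarz _ _ _)); rewrite -!sum_l2.
by apply: ler_pM; rewrite ?sumr_ge0 // => *; rewrite ?sqr_ge0 //;
  rewrite le_eqVlt; apply/orP; left; apply/eqP; apply: eq_bigr => p _; rewrite sqr_sqrtr ?l2_ge0.
Qed.

(** Each coordinate uses a single matrix, in the application the one selected by its query register.
    The family is thus block-diagonal, and the bound stays [eta] instead of growing with the number
    of matrices. *)
Lemma norm_sum_bform_le (X : finType) (idx : J -> X) (Gx : X -> S -> S -> R) eta
    v u (yes no : pred S) chi :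
  vanishes_off yes v -> vanishes_off no u -> 0 <= eta ->
  (forall x g f, vanishes_off yes g -> vanishes_off no f ->
     `|bform (Gx x) g f| <= eta * (Num.sqrt (l2 g) * Num.sqrt (l2 f))) ->
  l2 v = 1 -> l2 u = 1 -> (forall F, \sum_p chi F p ^+ 2 = 1) ->
  `|\sum_p bform (Gx (idx p)) (fun F => v F * chi F p) (fun F => u F * chi F p)|
    <= eta.
Proof.
move=> sv su eta_ge0 H v1 u1 chi1; apply: (le_trans (ler_norm_sum _ _ _)).
have unit w : l2 w = 1 -> \sum_p l2 (fun F => w F * chi F p) = 1.
  move=> w1; rewrite (sum_l2 w predT) -[RHS]w1.
  by apply: eq_bigr => F _; rewrite chi1 mulr1.
apply: (@le_trans _ _ (\sum_p eta * ((l2 (fun F => v F * chi F p) +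
   l2 (fun F => u F * chi F p)) / 2))).
  apply: ler_sum => p _; apply: (le_trans (H _ _ _ _ _)).
  - by move=> F nF; rewrite sv ?mul0r.
  - by move=> F nF; rewrite su ?mul0r.
  rewrite ler_wpM2l //.
  set a := l2 _; set b := l2 _.
  have a0 : 0 <= a by exact: l2_ge0.
  have b0 : 0 <= b by exact: l2_ge0.
  rewrite -[X in _ <= (X + _) / _]sqr_sqrtr // -[X in _ <= (_ + X) / _]sqr_sqrtr //.
  have := sqr_ge0 (Num.sqrt a - Num.sqrt b); nra.
rewrite -mulr_sumr -mulr_suml big_split /= !unit //; lra.
Qed.

End WeightedStates.

(** * The adversary bound *)

Section QueryAlgorithms.
Variable R : realType.

Lemma Re_sum (I : finType) (P : pred I) (z : I -> R[i]) :
  complex.Re (\sum_(i | P i) z i) = \sum_(i | P i) complex.Re (z i).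
Proof. by apply: (big_morph (@complex.Re R)) => // -[a b] [c d]. Qed.

(* A complex vector seen as a real vector of twice the dimension. *)
Definition coord (Sp : finType) (psi : {ffun Sp -> R[i]}) (p : Sp * bool) : R :=
  if p.2 then complex.Re (psi p.1) else complex.Im (psi p.1).

Lemma sum_coord (Sp : finType) (P : pred Sp) (psi phi : {ffun Sp -> R[i]}) :
  \sum_(p : Sp * bool | P p.1) coord psi p * coord phi p =
  complex.Re (\sum_(s | P s) conjc (psi s) * phi s).
Proof.
rewrite Re_sum.
rewrite (eq_bigl (fun p : Sp * bool => P p.1 && true)); last by move=> p; rewrite andbT.
rewrite -(pair_big P predT (fun s b => coord psi (s, b) * coord phi (s, b))) /=.
apply: eq_bigr => s _.
rewrite big_bool /coord /=; case: (psi s) (phi s) => [a b] [c d] /=; ring.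
Qed.

Lemma applyU_dot (Sp : finType) (U : {ffun Sp * Sp -> R[i]}) (psi phi : {ffun Sp -> R[i]}) :
  unitary U ->
  \sum_s conjc (applyU U psi s) * applyU U phi s = \sum_s conjc (psi s) * phi s.
Proof.
move=> hU.
transitivity (\sum_s \sum_t conjc (psi s) * phi t * \sum_k conjc (U (k, s)) * U (k, t)).
  transitivity (\sum_k \sum_s \sum_t
     conjc (psi s) * phi t * (conjc (U (k, s)) * U (k, t))).
    apply: eq_bigr => k _; rewrite !ffunE rmorph_sum mulr_suml.
    apply: eq_bigr => s _; rewrite mulr_sumr; apply: eq_bigr => t _.
    by rewrite rmorphM; ring.
  rewrite exchange_big /=; apply: eq_bigr => s _.
  rewrite exchange_big /=; apply: eq_bigr => t _.
  by rewrite mulr_sumr.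
apply: eq_bigr => s _; rewrite (bigD1 s) //= hU eqxx mulr1.
rewrite big1 ?addr0 // => t; rewrite eq_sym => ts.
by rewrite hU (negPf ts) mulr0.
Qed.

(** A number is below [2 ^ m] exactly when its shift right by [m] is zero, and shifts commute with
    xor. Hence the modulus in [xorI] acts as the identity. *)
Lemma lxor_lt_pow2 m (a b : nat) :
  (a < 2 ^ m)%N -> (b < 2 ^ m)%N -> (PeanoNat.Nat.lxor a b < 2 ^ m)%N.
Proof.
have pow2E k : (2 ^ k)%N = PeanoNat.Nat.pow 2 k.
  by elim: k => // k IH; rewrite expnS IH PeanoNat.Nat.pow_succ_r'.
rewrite !pow2E => /ssrnat.ltP la /ssrnat.ltP lb; apply/ssrnat.ltP.
have small c : (c < PeanoNat.Nat.pow 2 m)%coq_nat ->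
    PeanoNat.Nat.shiftr c m = 0%N.
  by move=> lc; rewrite PeanoNat.Nat.shiftr_div_pow2 PeanoNat.Nat.div_small.
have := PeanoNat.Nat.shiftr_lxor a b m.
rewrite (small a) // (small b) // PeanoNat.Nat.lxor_0_l PeanoNat.Nat.shiftr_div_pow2.
move/PeanoNat.Nat.div_small_iff; apply.
by rewrite -pow2E; apply/eqP; rewrite expn_eq0.
Qed.

Lemma xorIK m (v : nat) : (v < 2 ^ m)%N -> involutive (fun y : 'I_(2 ^ m) => xorI y v).
Proof.
move=> lv y; apply: val_inj => /=.
have lt1 := lxor_lt_pow2 (ltn_ord y) lv.
rewrite (modn_small lt1) PeanoNat.Nat.lxor_assoc PeanoNat.Nat.lxor_nilpotent.
by rewrite PeanoNat.Nat.lxor_0_r modn_small.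
Qed.

Section Oracle.
Variables (D Rg m W : nat).
Hypothesis range : (Rg <= 2 ^ m)%N.
Implicit Types (L : {ffun 'I_D -> 'I_Rg}) (psi phi : {ffun Defs.space D m W -> R[i]}).

(** On the basis states that query [x], both oracles apply the same involution of the basis. *)
Lemma oracle_dot_slice x L L' psi phi : L x = L' x ->
  \sum_(s : Defs.space D m W | s.1.1 == x) conjc (oracle L psi s) * oracle L' phi s =
  \sum_(s : Defs.space D m W | s.1.1 == x) conjc (psi s) * phi s.
Proof.
move=> LL'.
have lv : (L x < 2 ^ m)%N := leq_trans (ltn_ord (L x)) range.
pose h (s : Defs.space D m W) : Defs.space D m W := (s.1.1, xorI s.1.2 (L x), s.2).
have hK : involutive h by move=> [[a b] c]; rewrite /h /= xorIK.
rewrite [RHS](reindex_inj (inv_inj hK)) /=.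
by apply: eq_bigr => s /eqP sx; rewrite !ffunE sx -LL' /h sx.
Qed.

Lemma oracle_dot L psi phi :
  \sum_(s : Defs.space D m W) conjc (oracle L psi s) * oracle L phi s =
  \sum_(s : Defs.space D m W) conjc (psi s) * phi s.
Proof.
rewrite (partition_big (fun s : Defs.space D m W => s.1.1) predT) //=.
rewrite [RHS](partition_big (fun s : Defs.space D m W => s.1.1) predT) //=.
by apply: eq_bigr => x _; apply: oracle_dot_slice.
Qed.

End Oracle.

(** * Progress of a query algorithm *)

Section Adversary.
Variables (D Rg : nat) (A : qalg R D Rg).
Local Notation Om := {ffun 'I_D -> 'I_Rg}.

Definition run_coord k (F : Om) := coord (qa_run A F k).

Lemma run_unit k F : \sum_p run_coord k F p ^+ 2 = 1.
Proof.
transitivity (complex.Re (\sum_s conjc (qa_run A F k s) * qa_run A F k s)).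
  by rewrite -(sum_coord predT); apply: eq_bigr => p _; rewrite expr2.
suff -> : \sum_s conjc (qa_run A F k s) * qa_run A F k s = 1 by [].
elim: k => [|k IH] /=; rewrite applyU_dot ?oracle_dot //; try exact: qa_unitary.
- rewrite (bigD1 (qa_init A)) //= !ffunE eqxx rmorph1 mulr1 big1 ?addr0 // => s ns.
  by rewrite !ffunE (negPf ns) mulr0.
- exact: qa_range.
Qed.

Lemma acc_probE F :
  acc_prob A F = \sum_(p | p.1 \in qa_acc A) run_coord (qa_T A) F p ^+ 2.
Proof.
rewrite (eq_bigr (fun p => run_coord (qa_T A) F p * run_coord (qa_T A) F p)); last first.
  by move=> p _; rewrite expr2.
rewrite (sum_coord (fun s => s \in qa_acc A)) Re_sum; apply: eq_bigr => s _.
by rewrite /sqnorm; case: (qa_run _ _ _ _) => a b /=; ring.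
Qed.

Variables (G : Om -> Om -> R) (Gx : 'I_D -> Om -> Om -> R).
(** Entries with [F' x = F x] are left free, since a query at [x] does not separate such inputs;
    they can be chosen to lower the norm of [Gx x]. *)
Hypothesis GxE : forall x (F' F : Om), F' x != F x -> Gx x F' F = G F' F.
Variables (yes no : pred Om) (eta : R).
Hypothesis eta_ge0 : 0 <= eta.
Hypothesis Gx_le : forall x g f, vanishes_off yes g -> vanishes_off no f ->
     `|bform (Gx x) g f| <= eta * (Num.sqrt (l2 g) * Num.sqrt (l2 f)).

Section Progress.
Variables (v u : Om -> R).
Hypotheses (sv : vanishes_off yes v) (su : vanishes_off no u).
Hypotheses (v1 : l2 v = 1) (u1 : l2 u = 1).

(** The unitary preserves inner products, and the oracle changes the slice at [x] only for pairs
    with [F' x != F x]. There [G] may be replaced by [Gx x], and the two resulting sums, before and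
    after the query, are each at most [eta] in absolute value. *)
Lemma progress_query k :
  progress G v u predT (run_coord k) - 2 * eta
    <= progress G v u predT (run_coord k.+1).
Proof.
pose Oc (F : Om) := coord (oracle F (qa_run A F k)).
have -> : progress G v u predT (run_coord k.+1) = progress G v u predT Oc.
  apply: eq_bigr => F' _; apply: eq_bigr => F _; congr (_ * _).
  by rewrite !(sum_coord predT) /= applyU_dot //; apply: qa_unitary.
pose idx (p : Defs.space D (qa_m A) (qa_W A) * bool) := p.1.1.1.
have Oc1 F : \sum_p Oc F p ^+ 2 = 1.
  rewrite -(run_unit k F).
  under eq_bigr do rewrite expr2; under [RHS]eq_bigr do rewrite expr2.
  by rewrite !(sum_coord predT) oracle_dot //; apply: qa_range.
have b1 := norm_sum_bform_le idx sv su eta_ge0 Gx_le v1 u1 (run_unit k).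
have b2 := norm_sum_bform_le idx sv su eta_ge0 Gx_le v1 u1 Oc1.
have pE chi : \sum_p bform (Gx (idx p)) (fun F => v F * chi F p) (fun F => u F * chi F p)
   = \sum_x progress (Gx x) v u (fun p => idx p == x) chi.
  rewrite (partition_big idx predT) //=; apply: eq_bigr => x _.
  by rewrite progress_bform; apply: eq_bigr => p /eqP ->.
have dE : progress G v u predT Oc - progress G v u predT (run_coord k) =
   \sum_x progress (Gx x) v u (fun p => idx p == x) Oc
   - \sum_x progress (Gx x) v u (fun p => idx p == x) (run_coord k).
  have sliceE (chi1 chi2 : _ -> R) : \sum_p chi1 p * chi2 p =
     \sum_x \sum_(p | idx p == x) chi1 p * chi2 p.
    by rewrite (partition_big idx predT).
  have exch chi : \sum_x progress (Gx x) v u (fun p => idx p == x) chi =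
     \sum_F' \sum_F \sum_x Gx x F' F * v F' * u F *
        \sum_(p | idx p == x) chi F' p * chi F p.
    rewrite exchange_big /=; apply: eq_bigr => F' _.
    by rewrite exchange_big.
  rewrite !exch -!sumrB; apply: eq_bigr => F' _.
  rewrite -!sumrB; apply: eq_bigr => F _.
  rewrite !sliceE !mulr_sumr -!sumrB; apply: eq_bigr => x _.
  have [eqx|neqx] := eqVneq (F' x) (F x); last by rewrite GxE.
  rewrite !(sum_coord (fun s => s.1.1 == x)) oracle_dot_slice ?subrr //.
  exact: qa_range.
rewrite !pE in b1 b2.
move: dE b1 b2; rewrite !ler_norml => dE /andP[_ b1] /andP[b2 _]; lra.
Qed.

Lemma progress_run k :
  bform G v u - k%:R * (2 * eta) <= progress G v u predT (run_coord k).
Proof.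
elim: k => [|k IH]; last first.
  by have := progress_query k; rewrite -natr1; lra.
rewrite mul0r subr0 le_eqVlt; apply/orP; left; apply/eqP.
apply: eq_bigr => F' _; apply: eq_bigr => F _.
(* Before the first query the state does not depend on the input, so all inner products are 1. *)
suff -> : \sum_p run_coord 0 F' p * run_coord 0 F p = 1 by rewrite mulr1.
by rewrite -(run_unit 0 F'); apply: eq_bigr => p _; rewrite expr2.
Qed.

(** Splitting the coordinates into accepting and rejecting ones bounds the progress by [c] times the
    fidelity of two coins whose biases are [w v >= p1] and [w u <= p0]. *)
Lemma progress_end c p0 p1 : 0 <= c ->
  (forall g f, vanishes_off yes g -> vanishes_off no f ->
     bform G g f <= c * (Num.sqrt (l2 g) * Num.sqrt (l2 f))) ->
  (forall F, yes F -> p1 <= acc_prob A F) ->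
  (forall F, no F -> acc_prob A F <= p0) -> p0 <= p1 ->
  progress G v u predT (run_coord (qa_T A)) <= c * (1 - (p1 - p0) ^+ 2 / 2).
Proof.
move=> c_ge0 hc hyes hno p01.
set chi := run_coord (qa_T A).
pose w (u : Om -> R) := \sum_F u F ^+ 2 * acc_prob A F.
have rejE F : \sum_(p | p.1 \notin qa_acc A) chi F p ^+ 2 = 1 - acc_prob A F.
  rewrite -(run_unit (qa_T A) F) [in RHS](bigID (fun p => p.1 \in qa_acc A)) /=.
  by rewrite acc_probE [X in _ = X - _]addrC addrK.
have ap01 F : 0 <= acc_prob A F <= 1.
  apply/andP; split; last rewrite -subr_ge0 -rejE.
    by rewrite acc_probE; apply: sumr_ge0 => p _; apply: sqr_ge0.
  by apply: sumr_ge0 => p _; apply: sqr_ge0.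
have rej u' : l2 u' = 1 ->
   \sum_F u' F ^+ 2 * \sum_(p | p.1 \notin qa_acc A) chi F p ^+ 2 = 1 - w u'.
  move=> <-; rewrite -sumrB; apply: eq_bigr => F _; rewrite rejE; ring.
have acc u' :
   \sum_F u' F ^+ 2 * \sum_(p | p.1 \in qa_acc A) chi F p ^+ 2 = w u'.
  by apply: eq_bigr => F _; rewrite acc_probE.
have w01 u' : l2 u' = 1 -> 0 <= w u' <= 1.
  move=> h; apply/andP; split.
    by apply: sumr_ge0 => F _; rewrite mulr_ge0 ?sqr_ge0 //; case/andP: (ap01 F).
  rewrite -h; apply: ler_sum => F _; rewrite ler_piMr ?sqr_ge0 //.
  by case/andP: (ap01 F).
have wv : p1 <= w v.
  rewrite -[p1]mul1r -v1 mulr_suml; apply: ler_sum => F _.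
  case: (boolP (yes F)) => [yF|/sv ->]; last by rewrite expr0n /= !mul0r.
  by rewrite ler_wpM2l ?sqr_ge0 ?hyes.
have wu : w u <= p0.
  rewrite -[p0]mul1r -u1 mulr_suml; apply: ler_sum => F _.
  case: (boolP (no F)) => [nF|/su ->]; last by rewrite expr0n /= !mul0r.
  by rewrite ler_wpM2l ?sqr_ge0 ?hno.
have -> : progress G v u predT chi =
   progress G v u (fun p => p.1 \in qa_acc A) chi +
   progress G v u (fun p => p.1 \notin qa_acc A) chi.
  rewrite !progress_bform (bigID (fun p => p.1 \in qa_acc A)) /=.
  by [].
have l1 := progress_le (fun p => p.1 \in qa_acc A) chi sv su c_ge0 hc.
have l2 := progress_le (fun p => p.1 \notin qa_acc A) chi sv su c_ge0 hc.
rewrite !acc in l1; rewrite !rej // in l2.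
apply: (le_trans (lerD l1 l2)); rewrite -mulrDr ler_wpM2l //.
have {w01} [/andP[x0 x1] /andP[y0 y1]] := (w01 v v1, w01 u u1).
set x := w v in wv x0 x1 *; set y := w u in wu y0 y1 *.
apply: (@le_trans _ _ (1 - (x - y) ^+ 2 / 2)); last first.
  by rewrite lerD2l lerN2 ler_wpM2r ?invr_ge0 // ler_pXn2r ?nnegrE ?subr_ge0 //; lra.
rewrite !sqrtrM //; last by rewrite subr_ge0.
have x1' : 0 <= 1 - x by rewrite subr_ge0.
have y1' : 0 <= 1 - y by rewrite subr_ge0.
have := sqr_sqrtr x1'; have := sqr_sqrtr y1'.
have := sqr_sqrtr x0; have := sqr_sqrtr y0.
set a := Num.sqrt x; set b := Num.sqrt y.
set c' := Num.sqrt (1 - x); set d := Num.sqrt (1 - y) => bE aE dE cE.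
(* With [a], [c'] and [b], [d] as sine and cosine of two angles, [e1] and [e2] are the Pythagorean
   identities for their difference and sum, and [e3] is sin^2 s - sin^2 t = sin(s - t) sin(s + t),
   squared. *)
have e1 : (a * b + c' * d) ^+ 2 + (a * d - b * c') ^+ 2 = 1.
  transitivity ((a ^+ 2 + c' ^+ 2) * (b ^+ 2 + d ^+ 2)); first by ring.
  by rewrite aE bE cE dE; ring.
have e2 : (a * d + b * c') ^+ 2 + (a * b - c' * d) ^+ 2 = 1.
  transitivity ((a ^+ 2 + c' ^+ 2) * (b ^+ 2 + d ^+ 2)); first by ring.
  by rewrite aE bE cE dE; ring.
have e3 : (x - y) ^+ 2 = (a * d - b * c') ^+ 2 * (a * d + b * c') ^+ 2.
  transitivity ((a ^+ 2 * d ^+ 2 - b ^+ 2 * c' ^+ 2) ^+ 2); last by ring.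
  by rewrite aE bE cE dE; ring.
have e4 : (x - y) ^+ 2 <= (a * d - b * c') ^+ 2.
  by rewrite e3 ler_piMr ?sqr_ge0 // -e2 lerDl sqr_ge0.
(* From (cos t - 1)^2 >= 0 one gets cos t <= 1 - sin^2 t / 2. *)
have := sqr_ge0 (a * b + c' * d - 1); lra.
Qed.

End Progress.

(** At near-maximisers [v], [u] the progress starts above [c - eps], drops by at most [2 * eta] per
    query and ends below the bound of [progress_end]. Letting [eps] tend to 0 bounds [c] from above,
    while [g0] and [f0] bound it from below. *)
Lemma general_adversary g0 f0 p0 p1 :
  vanishes_off yes g0 -> vanishes_off no f0 -> 0 < bform G g0 f0 ->
  (forall F, yes F -> p1 <= acc_prob A F) ->
  (forall F, no F -> acc_prob A F <= p0) -> p0 <= p1 ->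
  (p1 - p0) ^+ 2 * bform G g0 f0 <=
  4 * (qa_T A)%:R * eta * (Num.sqrt (l2 g0) * Num.sqrt (l2 f0)).
Proof.
move=> sg0 sf0 G0_gt0 hyes hno p01.
have pos w : 0 < bform G g0 f0 -> w = g0 \/ w = f0 -> 0 < l2 w.
  move=> G0 wE; rewrite lt0r l2_ge0 andbT; apply/negP => /eqP w0.
  have {}w0 F : w F = 0.
    apply/eqP; rewrite -sqrf_eq0.
    have /allP H := etrans (esym (psumr_eq0 _ (fun i _ => sqr_ge0 (w i))))
      (introT eqP w0).
    by apply: H; rewrite mem_index_enum.
  suff G00 : bform G g0 f0 = 0 by rewrite G00 ltxx in G0.
  rewrite /bform big1 // => F' _; rewrite big1 // => F _.
  by case: wE => wE; rewrite -wE w0 ?mulr0 ?mul0r.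
have g0_gt0 : 0 < l2 g0 by apply: pos => //; left.
have f0_gt0 : 0 < l2 f0 by apply: pos => //; right.
have [c [hc happrox]] := bform_norm G sg0 sf0 g0_gt0 f0_gt0.
set nn := Num.sqrt (l2 g0) * Num.sqrt (l2 f0).
have nn_gt0 : 0 < nn by rewrite mulr_gt0 // sqrtr_gt0.
have G0_le : bform G g0 f0 <= c * nn by exact: hc.
have c_ge0 : 0 <= c by rewrite -(pmulr_lge0 _ nn_gt0) (le_trans (ltW G0_gt0)).
have key : c * ((p1 - p0) ^+ 2 / 2) <= (qa_T A)%:R * (2 * eta).
  apply/ler_addgt0Pr => eps eps_gt0.
  have [v [u [sv su v1 u1 lt]]] := happrox _ eps_gt0.
  have := progress_run sv su v1 u1 (qa_T A).
  have := progress_end sv su v1 u1 c_ge0 hc hyes hno p01.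
  lra.
apply: (@le_trans _ _ ((p1 - p0) ^+ 2 * (c * nn))).
  by rewrite ler_wpM2l ?sqr_ge0.
rewrite mulrA -subr_ge0 -mulrBl pmulr_lge0 //; lra.
Qed.

End Adversary.
End QueryAlgorithms.

(** * Averaging operators on functions of the input *)

Section Averaging.
Variables (R : realType) (I V : finType).
Hypothesis V_gt0 : (0 < #|V|)%N.
Local Notation Om := {ffun I -> V}.
Local Notation Fn := {ffun Om -> R^o}.
Local Notation N := (#|V|%:R : R).
Implicit Types (f g h : Fn) (F : Om) (a b i j x : I) (s : seq I).

(** [R^o] is [R] as a module over itself, which makes [Fn] a vector space on which operators can be
    declared linear; these rules return to arithmetic in [R]. *)
Lemma fnD f g F : (f + g) F = (f F : R) + (g F : R) :> R.
Proof. by rewrite ffunE. Qed.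

Lemma fnN f F : (- f) F = - (f F : R) :> R.
Proof. by rewrite ffunE. Qed.

Lemma fnZ (c : R) f F : (c *: f) F = c * (f F : R) :> R.
Proof. by rewrite ffunE. Qed.

Definition fnE := (fnD, fnN, fnZ).

Definition upd F i (v : V) : Om := [ffun j => if j == i then v else F j].

Lemma upd_same F i v : upd F i v i = v.
Proof. by rewrite ffunE eqxx. Qed.

Lemma upd_other F i v j : j != i -> upd F i v j = F j.
Proof. by move=> ji; rewrite ffunE (negPf ji). Qed.

Lemma upd_upd F i v w : upd (upd F i v) i w = upd F i w.
Proof. by apply/ffunP => j; rewrite !ffunE; case: eqP. Qed.

Lemma upd_id F i : upd F i (F i) = F.
Proof. by apply/ffunP => j; rewrite ffunE; case: eqP => // ->. Qed.

Lemma updC F i j v w : i != j -> upd (upd F i v) j w = upd (upd F j w) i v.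
Proof.
move=> ij; apply/ffunP => k; rewrite !ffunE.
by case: (eqVneq k j) => // ->; rewrite eq_sym (negPf ij).
Qed.

(** The orthogonal projection onto the functions that ignore coordinate [i]. *)
Definition avg i f : Fn := [ffun F => N^-1 * \sum_v (f (upd F i v) : R)].

Lemma avgE i f F : avg i f F = N^-1 * \sum_v (f (upd F i v) : R) :> R.
Proof. by rewrite ffunE. Qed.

Lemma N_neq0 : N != 0.
Proof. by rewrite pnatr_eq0 -lt0n. Qed.

Lemma mean_const (c : R) : N^-1 * (\sum_(v : V) c) = c.
Proof. by rewrite sumr_const -[c *+ _]mulr_natl mulrA mulVf ?mul1r // N_neq0. Qed.

Lemma avg_linear i c f g : avg i (c *: f + g) = c *: avg i f + avg i g.
Proof.
apply/ffunP => F; rewrite fnD fnZ !avgE.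
under eq_bigr do rewrite fnD fnZ.
by rewrite big_split /= -mulr_sumr; ring.
Qed.

HB.instance Definition _ i :=
  GRing.isLinear.Build R Fn Fn _ (avg i) (avg_linear i).

Lemma avgD i f g : avg i (f + g) = avg i f + avg i g.
Proof. exact: linearD. Qed.

Lemma avgB i f g : avg i (f - g) = avg i f - avg i g.
Proof. exact: linearB. Qed.

Lemma avgZ i c f : avg i (c *: f) = c *: avg i f.
Proof. exact: linearZ. Qed.

Lemma avg_upd i f F v : avg i f (upd F i v) = avg i f F.
Proof. by rewrite !avgE; congr (_ * _); apply: eq_bigr => w _; rewrite upd_upd. Qed.

Lemma avg_invariant i f : (forall F v, f (upd F i v) = f F) -> avg i f = f.
Proof.
move=> fi; apply/ffunP => F; rewrite avgE -[RHS](mean_const (f F)).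
by congr (_ * _); apply: eq_bigr => v _.
Qed.

Lemma avg_idem i f : avg i (avg i f) = avg i f.
Proof. by apply: avg_invariant => F v; rewrite avg_upd. Qed.

Lemma avgC i j f : avg i (avg j f) = avg j (avg i f).
Proof.
have [->//|ij] := eqVneq i j.
apply/ffunP => F; rewrite !avgE; congr (_ * _).
under eq_bigr do rewrite avgE; under [RHS]eq_bigr do rewrite avgE.
rewrite -!mulr_sumr exchange_big /=; congr (_ * _).
by apply: eq_bigr => v _; apply: eq_bigr => w _; rewrite updC.
Qed.

(** Swapping the stored value [F i] with the fresh value [v] is an involution of [Om * V], so
    resampling preserves the uniform measure. *)
Lemma sum_avg i (f : Om -> R) :
  \sum_F f F = \sum_F N^-1 * \sum_v f (upd F i v).
Proof.
rewrite -mulr_sumr pair_big /=.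
pose h (p : Om * V) := (upd p.1 i p.2, p.1 i).
have hK : involutive h.
  by move=> [F v]; rewrite /h /= upd_upd upd_same upd_id.
rewrite (reindex_inj (inv_inj hK)) /=.
rewrite (eq_bigr (fun p : Om * V => f p.1)); last first.
  by move=> p _; rewrite upd_upd upd_id.
rewrite -(pair_big predT predT (fun F (v : V) => f F)) /=.
rewrite mulr_sumr; apply: eq_bigr => F _.
by rewrite mean_const.
Qed.

Definition dot f g : R := \sum_F (f F : R) * (g F : R).

Lemma dot_avg i f g : dot (avg i f) g = dot (avg i f) (avg i g).
Proof.
rewrite /dot (sum_avg i); apply: eq_bigr => F _.
rewrite [avg i g F]avgE [RHS]mulrCA [in RHS]mulr_sumr; congr (_ * _).
by apply: eq_bigr => v _; rewrite avg_upd.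
Qed.

Lemma dotC f g : dot f g = dot g f.
Proof. by apply: eq_bigr => F _; rewrite mulrC. Qed.

Lemma dot_avgC i f g : dot (avg i f) g = dot f (avg i g).
Proof. by rewrite dot_avg [RHS]dotC [RHS]dot_avg dotC. Qed.

(** The mixed term vanishes because [avg i f] is orthogonal to [f - avg i f]. *)
Lemma l2_avg_split i c d f :
  l2 (c *: avg i f + d *: (f - avg i f))
    = c ^+ 2 * l2 (avg i f) + d ^+ 2 * l2 (f - avg i f).
Proof.
transitivity (c ^+ 2 * l2 (avg i f) + d ^+ 2 * l2 (f - avg i f)
  + 2 * c * d * (dot (avg i f) f - dot (avg i f) (avg i f))); last first.
  by rewrite -dot_avg subrr mulr0 addr0.
rewrite /l2 /dot -sumrB !mulr_sumr -!big_split /=; apply: eq_bigr => F _.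
by move: (avg i f) => A; rewrite !fnE; ring.
Qed.

Lemma l2_avg_pythagoras i f : l2 f = l2 (avg i f) + l2 (f - avg i f).
Proof.
have := l2_avg_split i 1 1 f; rewrite !scale1r expr1n !mul1r => <-.
by rewrite addrC subrK.
Qed.

Lemma l2_avg_le i f : l2 (avg i f) <= l2 f.
Proof. by rewrite [leRHS](l2_avg_pythagoras i) lerDl l2_ge0. Qed.

(** * The noise operator and its telescoping loss of norm *)

Variable r : R.
Hypotheses (r_ge0 : 0 <= r) (r_lt1 : r < 1).

Let r_le1 : r <= 1.
Proof. exact: ltW. Qed.

Definition damp i f : Fn := r *: f + (1 - r) *: avg i f.
Definition noise s f : Fn := foldr damp f s.

Lemma damp_linear i c f g : damp i (c *: f + g) = c *: damp i f + damp i g.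
Proof.
by apply/ffunP => F; rewrite /damp avg_linear !fnE; ring.
Qed.

Lemma noise_linear s c f g : noise s (c *: f + g) = c *: noise s f + noise s g.
Proof. by elim: s => //= i s ->; rewrite damp_linear. Qed.

HB.instance Definition _ i :=
  GRing.isLinear.Build R Fn Fn _ (damp i) (damp_linear i).
HB.instance Definition _ s :=
  GRing.isLinear.Build R Fn Fn _ (noise s) (noise_linear s).

Lemma avg_damp i j f : avg i (damp j f) = damp j (avg i f).
Proof. by rewrite /damp avgD !avgZ avgC. Qed.

Lemma avg_noise i s f : avg i (noise s f) = noise s (avg i f).
Proof. by elim: s => //= j s <-; rewrite avg_damp. Qed.

Lemma dampC i j f : damp i (damp j f) = damp j (damp i f).
Proof. by apply/ffunP => F; rewrite /damp !avgD !avgZ (avgC i j) !fnE; ring. Qed.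

Lemma noise_damp i s f : noise s (damp i f) = damp i (noise s f).
Proof. by elim: s => //= j s ->; rewrite dampC. Qed.

(** The factors commute, so the factor of any chosen coordinate can be pulled to the front. *)
Lemma noise_perm s1 s2 f : perm_eq s1 s2 -> noise s1 f = noise s2 f.
Proof.
elim: s1 s2 => [|i s1 IH] s2.
  by rewrite perm_sym => /perm_nilP ->.
move=> p; have i_s2 : i \in s2 by rewrite -(perm_mem p) mem_head.
have [s [t s2E]] : exists s t, s2 = s ++ i :: t.
  by case/splitPr: i_s2 => s t; exists s, t.
move: p; rewrite s2E perm_sym perm_catC /= perm_cons => p.
rewrite /= (IH (s ++ t)); last by rewrite perm_sym perm_catC.
by rewrite /noise !foldr_cat /= -/(noise s _) -/(noise s _) noise_damp.
Qed.

(** Spectral form: eigenvalue 1 on the range of [avg i], eigenvalue [r] on its orthogonal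
    complement. *)
Lemma dampE i f : damp i f = 1 *: avg i f + r *: (f - avg i f).
Proof. by apply/ffunP => F; rewrite /damp !fnE; ring. Qed.

Lemma l2_dampE i f : l2 (damp i f) = l2 f - (1 - r ^+ 2) * l2 (f - avg i f).
Proof.
rewrite dampE l2_avg_split [l2 f](l2_avg_pythagoras i); ring.
Qed.

Lemma l2_damp_le i f : l2 (damp i f) <= l2 f.
Proof.
rewrite l2_dampE lerBlDr lerDl mulr_ge0 ?l2_ge0 //.
by rewrite subr_ge0 exprn_ile1.
Qed.

Lemma l2_noise_le s f : l2 (noise s f) <= l2 f.
Proof. by elim: s => //= i s; apply: le_trans; apply: l2_damp_le. Qed.

(* Summing the losses [l2 g - l2 (damp i g)] over the successive factors of
   [noise s] telescopes. *)
Lemma sum_l2_noise s f :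
  (1 - r ^+ 2) * (\sum_(b <- s) l2 (noise s f - avg b (noise s f)))
    <= l2 f - l2 (noise s f).
Proof.
elim: s => [|i s IH]; first by rewrite big_nil mulr0 subrr.
rewrite big_cons /=; set g := noise s f in IH *.
have r2 : 0 <= 1 - r ^+ 2 by rewrite subr_ge0 exprn_ile1.
(* [damp i] is a contraction commuting with [avg b], so the terms of the tail can only shrink under
   the new factor. *)
have le b : l2 (damp i g - avg b (damp i g)) <= l2 (g - avg b g).
  have -> : damp i g - avg b (damp i g) = damp i (g - avg b g).
    by rewrite avg_damp linearB.
  exact: l2_damp_le.
rewrite mulrDr l2_dampE.
have H1 := ler_wpM2l r2 (le i).
have H2 : (1 - r ^+ 2) * (\sum_(b <- s) l2 (damp i g - avg b (damp i g))) <=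
    l2 f - l2 g.
  by apply: le_trans IH; rewrite ler_wpM2l //; apply: ler_sum => b _.
lra.
Qed.

(** * The adversary matrix for a planted collision *)

(** This is 1 - (1 - [avg a])(1 - [avg b]), the orthogonal projection onto sums of a function
    ignoring [a] and a function ignoring [b]. *)
Definition cross a b f : Fn := avg a f + avg b f - avg a (avg b f).

Lemma crossC a b f : cross a b f = cross b a f.
Proof. by rewrite /cross avgC [avg a f + _]addrC. Qed.

Lemma cross_linear a b c f g : cross a b (c *: f + g) = c *: cross a b f + cross a b g.
Proof. by apply/ffunP => F; rewrite /cross !avg_linear !fnE; ring. Qed.

Lemma noise_cross s a b f : noise s (cross a b f) = cross a b (noise s f).
Proof.
by rewrite /cross linearB linearD /= -!avg_noise.
Qed.

Lemma avg_cross i a b f : avg i (cross a b f) = cross a b (avg i f).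
Proof.
by rewrite /cross avgB avgD (avgC i a) (avgC i b) (avgC i a (avg b f)) (avgC i b f).
Qed.

Lemma noise_rem x f : noise (enum I) f = damp x (noise (rem x (enum I)) f).
Proof. by rewrite (@noise_perm _ (x :: rem x (enum I))) // perm_to_rem // mem_enum. Qed.

Definition indep i (f : Om -> R) := forall F v, f (upd F i v) = f F.

(** With the other values fixed, exactly one of the [N] values of [F a] equals [F b]. *)
Lemma sum_diag a b (f : Om -> R) : a != b -> indep a f ->
  \sum_(F : Om | F a == F b) f F = N^-1 * \sum_F f F.
Proof.
move=> ab fa; rewrite big_mkcond [LHS](sum_avg a) [RHS]mulr_sumr; apply: eq_bigr => F _.
congr (_ * _); rewrite -big_mkcond /= (eq_bigl (pred1 (F b))) ?big_pred1_eq ?fa // => v.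
by rewrite /= upd_same upd_other // eq_sym.
Qed.

Lemma sum_diag_r a b (f : Om -> R) : a != b -> indep b f ->
  \sum_(F : Om | F a == F b) f F = N^-1 * \sum_F f F.
Proof.
move=> ab fb; rewrite -(@sum_diag b a f) //; last by rewrite eq_sym.
by apply: eq_bigl => F; rewrite eq_sym.
Qed.

(** [cross a b h] is [g1 + g2] with [g1] ignoring [a] and [g2] ignoring [b], so each costs only a
    factor [N^-1] on the diagonal. The 2 comes from squaring the sum; the norms add up to at most
    [l2 h] by Pythagoras. *)
Lemma l2_cross_diag_le a b h : a != b ->
  \sum_(F : Om | F a == F b) (cross a b h F : R) ^+ 2 <= 2 * N^-1 * l2 h.
Proof.
move=> ab; set g1 := avg a h; set g2 := avg b (h - avg a h).
have -> : cross a b h = g1 + g2.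
  by rewrite /cross /g1 /g2 avgB (avgC a b) addrA.
apply: (@le_trans _ _ (\sum_(F : Om | F a == F b)
   (2 * (g1 F : R) ^+ 2 + 2 * (g2 F : R) ^+ 2))).
  apply: ler_sum => F _; rewrite fnD.
  have := sqr_ge0 ((g1 F : R) - (g2 F : R)); lra.
rewrite big_split /= -!mulr_sumr sum_diag //; last first.
  by move=> F v; rewrite /g1 avg_upd.
rewrite sum_diag_r //; last by move=> F v; rewrite /g2 avg_upd.
rewrite -mulrDr -mulrDr -mulrA ler_wpM2l // ler_wpM2l ?invr_ge0 ?ler0n //.
by rewrite [leRHS](l2_avg_pythagoras a) lerD2l l2_avg_le.
Qed.

(* [L] does not mix inputs that differ at the coordinate [x]. *)
Definition local_at x (L : Fn -> Fn) := forall f g F',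
  (forall F, F x = F' x -> f F = g F) -> L f F' = L g F'.

Lemma local_comp x L1 L2 :
  local_at x L1 -> local_at x L2 -> local_at x (fun f => L1 (L2 f)).
Proof.
move=> h1 h2 f g F' fg; apply: h1 => F FF'; apply: h2 => F2 F2F.
by apply: fg; rewrite F2F.
Qed.

Lemma local_avg x i : i != x -> local_at x (avg i).
Proof.
move=> ix f g F' fg; rewrite !avgE; congr (_ * _); apply: eq_bigr => v _.
by apply: fg; rewrite upd_other // eq_sym.
Qed.

Lemma local_scale x c L : local_at x L -> local_at x (fun f => c *: L f).
Proof. by move=> h f g F' fg; rewrite !fnZ (h f g). Qed.

Lemma local_add x L1 L2 :
  local_at x L1 -> local_at x L2 -> local_at x (fun f => L1 f + L2 f).
Proof. by move=> h1 h2 f g F' fg; rewrite !fnD (h1 f g) // (h2 f g). Qed.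

Lemma local_id x : local_at x id.
Proof. by move=> f g F'; apply. Qed.

Lemma local_noise x s : x \notin s -> local_at x (noise s).
Proof.
elim: s => [|i s IH]; first by move=> _; apply: local_id.
rewrite inE negb_or eq_sym => /andP[ix xs].
apply: (local_comp (L1 := damp i)); last exact: IH.
apply: (@local_add x (fun f => r *: f) (fun f => (1 - r) *: avg i f)); first exact: (@local_scale x r id (@local_id x)).
exact: (@local_scale x _ (avg i) (local_avg ix)).
Qed.

Lemma local_cross x a b : a != x -> b != x -> local_at x (cross a b).
Proof.
move=> ax bx f g F' fg; rewrite /cross !fnD !fnN.
rewrite (local_avg ax fg) (local_avg bx fg).
by rewrite (local_comp (local_avg ax) (local_avg bx) fg).
Qed.

(* [noise (enum I) (cross a b f)] with its part that is local at [x] removed;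
   only this part matters when the coordinate [x] is queried. *)
Definition partner x z f : Fn :=
  avg x (noise (rem x (enum I)) f - r *: avg z (noise (rem x (enum I)) f)).

(** Off [{a, b}], the summand [r] of [damp x] is local at [x] and only [(1 - r) avg x] survives. If
    [x] is [a] or [b], the local part is the one exhibited by [partnerE]. *)
Definition nonlocal x a b f : Fn :=
  if x == a then partner a b f else
  if x == b then partner b a f else
  (1 - r) *: cross a b (avg x (noise (rem x (enum I)) f)).

Lemma rem_enum_notin x : x \notin rem x (enum I).
Proof. by rewrite mem_rem_uniqF ?enum_uniq. Qed.

(** [avg a] absorbs [cross a b], which turns the left factor [damp a (cross a b p)] into
    [avg a p + r avg b p - r avg a (avg b p)]. *)
Lemma partnerE a b f :
  noise (enum I) (cross a b f) - partner a b f =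
  r *: avg b (noise (rem a (enum I)) f).
Proof.
rewrite (noise_rem a) noise_cross /partner; set p := noise _ f.
apply/ffunP => F; rewrite /damp /cross !avgB !avgD !avgZ !avg_idem.
by rewrite !fnE; ring.
Qed.

Lemma local_remainder x a b : a != b ->
  local_at x (fun f => noise (enum I) (cross a b f) - nonlocal x a b f).
Proof.
move=> ab; have loc z : z != x ->
    local_at x (fun f => r *: avg z (noise (rem x (enum I)) f)).
  move=> zx; apply: local_scale; apply: local_comp; first exact: local_avg.
  exact: local_noise (rem_enum_notin x).
rewrite /nonlocal; have [xa|xa] := eqVneq x a.
  by move=> f g F' fg; rewrite !partnerE -xa; apply: loc => //; rewrite xa eq_sym.
have [xb|xb] := eqVneq x b.
  move=> f g F' fg; rewrite (crossC a b f) (crossC a b g) !partnerE -xb.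
  by apply: loc => //; rewrite xb.
have E f : noise (enum I) (cross a b f) -
    (1 - r) *: cross a b (avg x (noise (rem x (enum I)) f)) =
    r *: cross a b (noise (rem x (enum I)) f).
  rewrite (noise_rem x) noise_cross /damp avg_cross.
  by apply/ffunP => F; rewrite !fnE; ring.
move=> f g F' fg; rewrite !E; move: f g F' fg; apply: local_scale.
apply: local_comp; first by apply: local_cross; rewrite eq_sym.
exact: local_noise (rem_enum_notin x).
Qed.

(** With [h = noise s (avg x f)], the partner is [(1 - r) avg z h] plus [h - avg z h], two
    orthogonal pieces. The first costs [(1 - r) ^+ 2] for each [z]; the second, summed over all [z],
    telescopes to at most [(1 - r)^-1 * l2 f]. *)
Lemma sum_partner_le x (P : pred I) (n : R) f :
  (forall z, P z -> z != x) -> #|P|%:R <= n ->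
  \sum_(z | P z) \sum_(F : Om | F x == F z) (partner x z f F : R) ^+ 2 <=
  N^-1 * (((1 - r)^-1 + n * (1 - r) ^+ 2) * l2 f).
Proof.
move=> Px cP; set s := rem x (enum I); pose h := noise s (avg x f).
have hf : l2 h <= l2 f by apply: le_trans (l2_avg_le x f); apply: l2_noise_le.
have partE z : partner x z f = (1 - r) *: avg z h + 1 *: (h - avg z h).
  rewrite /partner -/s avgB avgZ (avgC x z) avg_noise -/h.
  by apply/ffunP => F; rewrite !fnE; ring.
rewrite (eq_bigr (fun z => N^-1 * l2 (partner x z f))); last first.
  move=> z /Px zx; rewrite sum_diag //; first by rewrite eq_sym.
  by move=> F v; rewrite avg_upd.
rewrite -mulr_sumr ler_wpM2l ?invr_ge0 ?ler0n //.
rewrite (eq_bigr (fun z => (1 - r) ^+ 2 * l2 (avg z h) + l2 (h - avg z h))); last first.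
  by move=> z _; rewrite partE l2_avg_split expr1n mul1r.
rewrite big_split /= addrC mulrDl lerD //.
  have le1 : \sum_(z | P z) l2 (h - avg z h) <= \sum_(z <- s) l2 (h - avg z h).
    rewrite /s rem_filter ?enum_uniq // big_filter big_enum_cond /=.
    rewrite [leLHS]big_mkcond [leRHS]big_mkcond; apply: ler_sum => z _ /=.
    by case: ifP => [/Px ->//|_]; case: ifP => // _; apply: l2_ge0.
  apply: (le_trans le1).
  have := sum_l2_noise s (avg x f); rewrite -/h.
  set S := \sum_(z <- s) _ => leS.
  have S0 : 0 <= S by apply: sumr_ge0 => z _; apply: l2_ge0.
  have rr : 0 < 1 - r by rewrite subr_gt0.
  rewrite mulrC ler_pdivlMr //.
  have := l2_avg_le x f; have := l2_ge0 h.
  have : S * (1 - r) <= (1 - r ^+ 2) * S.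
    have -> : (1 - r ^+ 2) * S = S * (1 - r) + r * ((1 - r) * S) by ring.
    by rewrite lerDl !mulr_ge0 // ltW.
  lra.
apply: (@le_trans _ _ (\sum_(z | P z) (1 - r) ^+ 2 * l2 f)).
  apply: ler_sum => z _; rewrite ler_wpM2l ?sqr_ge0 //.
  exact: le_trans (l2_avg_le z h) hf.
rewrite sumr_const -mulr_natl mulrA ler_wpM2r ?l2_ge0 //.
by rewrite ler_wpM2r ?sqr_ge0.
Qed.

Variables (X : pred I) (n : R).
Hypotheses (cX : #|X|%:R <= n) (cY : #|predC X|%:R <= n).

(** The index set consists of inputs with a marked collision between the two sides; an input occurs
    once for each of its collisions. *)
Definition crosssum (c : I -> I -> Om -> R) : R :=
  \sum_(a | X a) \sum_(b | ~~ X b) \sum_(F : Om | F a == F b) c a b F.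

(** At most [n ^+ 2] pairs avoid [x], each costing [K]; the pairs containing [x] are handled
    together by [sum_partner_le]. *)
Lemma sum_nonlocal_le x f :
  crosssum (fun a b F => (nonlocal x a b f F : R) ^+ 2) <=
  N^-1 * ((2 * n ^+ 2 * (1 - r) ^+ 2 + (1 - r)^-1 + n * (1 - r) ^+ 2) * l2 f).
Proof.
have n_ge0 : 0 <= n by apply: le_trans cX; rewrite ler0n.
have off a b : a != b -> x != a -> x != b ->
   \sum_(F : Om | F a == F b) (nonlocal x a b f F : R) ^+ 2
     <= N^-1 * (2 * (1 - r) ^+ 2 * l2 f).
  move=> ab xa xb; rewrite /nonlocal (negPf xa) (negPf xb).
  rewrite (eq_bigr (fun F => (1 - r) ^+ 2 *
     (cross a b (avg x (noise (rem x (enum I)) f)) F : R) ^+ 2)); last first.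
    by move=> F _; rewrite fnZ exprMn.
  rewrite -mulr_sumr.
  apply: (le_trans (ler_wpM2l (sqr_ge0 _) (l2_cross_diag_le _ ab))).
  rewrite [leRHS](_ : _ = (1 - r) ^+ 2 * (2 * N^-1 * l2 f)); last by ring.
  rewrite ler_wpM2l ?sqr_ge0 // ler_wpM2l ?mulr_ge0 ?invr_ge0 ?ler0n //.
  exact: le_trans (l2_avg_le _ _) (l2_noise_le _ _).
set K := N^-1 * (2 * (1 - r) ^+ 2 * l2 f) in off.
have K0 : 0 <= K.
  rewrite /K; apply: mulr_ge0; first by rewrite invr_ge0 ler0n.
  by apply: mulr_ge0; [rewrite mulr_ge0 ?sqr_ge0|exact: l2_ge0].
have sumK (P : pred I) c : 0 <= c -> #|P|%:R <= n -> \sum_(z | P z) c <= n * c.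
  by move=> c0 Pn; rewrite sumr_const -[leLHS]mulr_natl ler_wpM2r.
have XY a b : X a -> ~~ X b -> a != b.
  by move=> Xa; apply: contraNneq => <-.
have nn : n * (n * K) = N^-1 * (2 * n ^+ 2 * (1 - r) ^+ 2 * l2 f).
  by rewrite /K; ring.
suff le : crosssum (fun a b F => (nonlocal x a b f F : R) ^+ 2) <=
   n * (n * K) + N^-1 * (((1 - r)^-1 + n * (1 - r) ^+ 2) * l2 f).
  apply: (le_trans le); rewrite nn -mulrDr -mulrDl addrA; exact: lexx.
(* Only one end of a pair can be [x], depending on its side; the second case exchanges the roles of
   [a] and [b]. *)
rewrite /crosssum; have [Xx|Xx] := boolP (X x).
  rewrite (bigD1 x) //= addrC lerD //.
    apply: (@le_trans _ _ (\sum_(a | X a) n * K)); last first.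
      by apply: sumK; rewrite // mulr_ge0.
    rewrite [leLHS]big_mkcondr; apply: ler_sum => a Xa; case: ifP => ax; last first.
      by rewrite mulr_ge0.
    apply: (@le_trans _ _ (\sum_(b | ~~ X b) K)); last exact: (sumK (predC X)).
    apply: ler_sum => b Xb; apply: off; [exact: XY|by rewrite eq_sym ax|exact: XY].
  apply: le_trans (sum_partner_le _ _ cY).
    by apply: ler_sum => b Xb; rewrite /nonlocal eqxx.
  by move=> z Xz; rewrite eq_sym XY.
rewrite exchange_big /= (bigD1 x) //= addrC lerD //.
  apply: (@le_trans _ _ (\sum_(b | ~~ X b) n * K)); last first.
    by apply: (sumK (predC X)); rewrite // mulr_ge0.
  rewrite [leLHS]big_mkcondr; apply: ler_sum => b Xb; case: ifP => bx; last first.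
    by rewrite mulr_ge0.
  apply: (@le_trans _ _ (\sum_(a | X a) K)); last exact: (sumK X).
  apply: ler_sum => a Xa; apply: off; [exact: XY|by rewrite eq_sym XY|by rewrite eq_sym bx].
apply: le_trans (sum_partner_le _ _ cX).
  apply: ler_sum => a Xa; have xa : x != a by rewrite eq_sym XY.
  rewrite /nonlocal eqxx (negPf xa).
  rewrite le_eqVlt; apply/orP; left; apply/eqP; apply: eq_bigl => F.
  by rewrite eq_sym.
by move=> z Xz; rewrite XY.
Qed.

(** * Matrices of the operators and their bilinear forms *)

Definition delta F : Fn := [ffun F' => (F' == F)%:R].

Definition additive_scalable (K : Fn -> Fn) :=
  forall c f g, K (c *: f + g) = c *: K f + K g.

Lemma additive_scalable0 K : additive_scalable K -> K 0 = 0.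
Proof. by move=> /(_ (-1) 0 0); rewrite scaler0 addr0 scaleN1r addNr. Qed.

Lemma delta_expand K f F' : additive_scalable K ->
  K f F' = \sum_F (f F : R) * (K (delta F) F' : R) :> R.
Proof.
move=> hK; have {1}-> : f = \sum_F (f F : R) *: delta F.
  apply/ffunP => F; rewrite sum_ffunE (bigD1 F) //= big1 => [|F2 F2F].
    by rewrite addr0 fnZ ffunE eqxx mulr1.
  by rewrite fnZ ffunE eq_sym (negPf F2F) mulr0.
have KD f1 f2 : K (f1 + f2) F' = (K f1 F' : R) + (K f2 F' : R) :> R.
  by rewrite -{1}[f1]scale1r hK fnD scale1r.
have K0 : K 0 F' = 0 :> R by rewrite (additive_scalable0 hK) ffunE.
rewrite (big_morph (fun h => K h F' : R) KD K0); apply: eq_bigr => F _.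
by rewrite -[_ *: _]addr0 hK (additive_scalable0 hK) addr0 fnZ.
Qed.

Definition kernel_of (K : I -> I -> Fn -> Fn) (F' F : Om) : R :=
  \sum_(a | X a) \sum_(b | ~~ X b) (F' a == F' b)%:R * (K a b (delta F) F' : R).

Lemma crosssumE c : crosssum c =
  \sum_(F : Om) \sum_(a | X a) \sum_(b | ~~ X b) (F a == F b)%:R * c a b F.
Proof.
rewrite [RHS]exchange_big /=; apply: eq_bigr => a _.
rewrite [RHS]exchange_big /=; apply: eq_bigr => b _.
by rewrite big_mkcond; apply: eq_bigr => F _; case: eqP; rewrite ?mul1r ?mul0r.
Qed.

Lemma bform_kernel K (g f : Om -> R) : (forall a b, additive_scalable (K a b)) ->
  bform (kernel_of K) g f =
  crosssum (fun a b F => g F * (K a b [ffun F => f F] F : R)).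
Proof.
move=> hK; rewrite crosssumE; apply: eq_bigr => F' _.
transitivity (\sum_F \sum_(a | X a) \sum_(b | ~~ X b)
   (F' a == F' b)%:R * (K a b (delta F) F' : R) * g F' * f F).
  apply: eq_bigr => F _; rewrite !mulr_suml; apply: eq_bigr => a _.
  by rewrite !mulr_suml.
rewrite exchange_big /=; apply: eq_bigr => a _.
rewrite exchange_big /=; apply: eq_bigr => b _.
rewrite (delta_expand _ _ (hK a b)) !mulr_sumr; apply: eq_bigr => F _.
rewrite ffunE; ring.
Qed.

Definition planted a b f : Fn := noise (enum I) (cross a b f).

Lemma planted_linear a b : additive_scalable (planted a b).
Proof. by move=> c f g; rewrite /planted cross_linear noise_linear. Qed.

Lemma partner_linear x z : additive_scalable (partner x z).
Proof.
move=> c f g; rewrite /partner noise_linear !avgB !avgZ !avg_linear.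
by apply/ffunP => F; rewrite !fnE; ring.
Qed.

Lemma nonlocal_linear x a b : additive_scalable (nonlocal x a b).
Proof.
move=> c f g; rewrite /nonlocal; case: ifP => _; first exact: partner_linear.
case: ifP => _; first exact: partner_linear.
rewrite noise_linear avg_linear cross_linear.
by apply/ffunP => F; rewrite !fnE; ring.
Qed.

Lemma cross_pair_neq a b : X a -> ~~ X b -> a != b.
Proof. by move=> Xa; apply: contraNneq => <-. Qed.

Lemma kernel_nonlocalE x (F' F : Om) : F' x != F x ->
  kernel_of (nonlocal x) F' F = kernel_of planted F' F.
Proof.
move=> F'F; apply: eq_bigr => a Xa; apply: eq_bigr => b Xb; congr (_ * _).
(* Locality is applied to [delta F] and 0, which agree on all inputs with value [F' x] at [x]
   because [F x] differs from it. *)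
have := @local_remainder x a b (cross_pair_neq Xa Xb) (delta F) 0 F'.
rewrite -/(planted a b _) -/(planted a b _) (additive_scalable0 (planted_linear a b)).
rewrite (additive_scalable0 (nonlocal_linear x a b)) subr0 fnD fnN ffunE.
move=> h; apply/eqP; rewrite eq_sym -subr_eq0; apply/eqP; apply: h => F2 F2F'.
rewrite !ffunE; case: eqP => // F2F; move: F'F.
by rewrite -F2F' F2F eqxx.
Qed.

Lemma crosssum_cauchy (g : Om -> R) (c : I -> I -> Om -> R) :
  crosssum (fun a b F => g F * c a b F) ^+ 2 <=
  crosssum (fun a b F => g F ^+ 2) * crosssum (fun a b F => c a b F ^+ 2).
Proof.
have E d : crosssum d = \sum_(t : I * (I * Om) |
    X t.1 && (~~ X t.2.1 && (t.2.2 t.1 == t.2.2 t.2.1))) d t.1 t.2.1 t.2.2.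
  rewrite /crosssum -(pair_big_dep X
    (fun a (q : I * Om) => ~~ X q.1 && (q.2 a == q.2 q.1))
    (fun a (q : I * Om) => d a q.1 q.2)) /=.
  apply: eq_bigr => a _.
  by rewrite -(pair_big_dep (fun b => ~~ X b) (fun b (F : Om) => F a == F b)
     (fun b F => d a b F)).
rewrite !E; exact: cauchy_schwarz.
Qed.

Variables (yes no : pred Om).
Hypothesis yes_pair : forall F, yes F ->
  \sum_(a | X a) \sum_(b | ~~ X b) (F a == F b)%:R = 1 :> R.

(** Cauchy-Schwarz over marked collisions separates [g] from [f]. A [yes] input has exactly one
    marked collision, so the [g] part is at most [l2 g]; the [f] part is [sum_nonlocal_le]. *)
Lemma bform_nonlocal_le x (g f : Om -> R) : vanishes_off yes g ->
  `|bform (kernel_of (nonlocal x)) g f| <=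
  Num.sqrt (N^-1 * (2 * n ^+ 2 * (1 - r) ^+ 2 + (1 - r)^-1 + n * (1 - r) ^+ 2)) *
  (Num.sqrt (l2 g) * Num.sqrt (l2 f)).
Proof.
move=> sg; rewrite bform_kernel; last exact: nonlocal_linear.
have gle : crosssum (fun a b F => g F ^+ 2) <= l2 g.
  rewrite crosssumE; apply: ler_sum => F _.
  rewrite (eq_bigr (fun a => (\sum_(b | ~~ X b) (F a == F b)%:R) * g F ^+ 2)).
    rewrite -mulr_suml; case: (boolP (yes F)) => [/yes_pair ->|/sg ->].
      by rewrite mul1r.
    by rewrite expr0n mulr0.
  by move=> a _; rewrite mulr_suml.
have fE : l2 [ffun F => f F] = l2 f by apply: eq_bigr => F _; rewrite ffunE.
have := sum_nonlocal_le x [ffun F => f F]; rewrite fE.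
set K := 2 * n ^+ 2 * _ + _ + _ => cle.
have rr : 0 < 1 - r by rewrite subr_gt0.
have n_ge0 : 0 <= n by apply: le_trans cX; rewrite ler0n.
have K0 : 0 <= N^-1 * K.
  apply: mulr_ge0; first by rewrite invr_ge0 ler0n.
  rewrite /K; apply: addr_ge0; first apply: addr_ge0.
  - by apply: mulr_ge0; rewrite ?sqr_ge0 // mulr_ge0 ?sqr_ge0.
  - by rewrite invr_ge0 ltW.
  - by apply: mulr_ge0; rewrite ?sqr_ge0.
rewrite -sqrtr_sqr -sqrtrM ?l2_ge0 // -sqrtrM //; apply: ler_wsqrtr.
apply: (le_trans (crosssum_cauchy _ _)); rewrite mulrCA; apply: ler_pM => //.
- by rewrite crosssumE; do 3 (apply: sumr_ge0 => ? _); rewrite mulr_ge0 ?sqr_ge0 ?ler0n.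
- by rewrite crosssumE; do 3 (apply: sumr_ge0 => ? _); rewrite mulr_ge0 ?sqr_ge0 ?ler0n.
- by rewrite -mulrA.
Qed.

(** * Legal inputs have constant weight *)

Lemma dot_linear_l (c d : R) f h g : dot (c *: f + d *: h) g = c * dot f g + d * dot h g.
Proof.
rewrite /dot !mulr_sumr -big_split /=; apply: eq_bigr => F _.
by rewrite !fnE; ring.
Qed.

Lemma dot_damp i f g : dot (damp i f) g = dot f (damp i g).
Proof. by rewrite /damp dot_linear_l dot_avgC ![dot f _]dotC dot_linear_l. Qed.

Lemma dot_noise s f g : dot (noise s f) g = dot f (noise s g).
Proof. by elim: s g => //= i s IH g; rewrite dot_damp IH noise_damp. Qed.

Lemma dot_cross a b f g : dot (cross a b f) g = dot f (cross a b g).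
Proof.
have E h1 h2 : dot (cross a b h1) h2 =
    dot (avg a h1) h2 + dot (avg b h1) h2 - dot (avg a (avg b h1)) h2.
  rewrite /dot -sumrN -!big_split /=; apply: eq_bigr => F _.
  by rewrite /cross !fnE; ring.
by rewrite E !dot_avgC [RHS]dotC E !(dotC _ f) (avgC b a).
Qed.

Definition const (c : R) : Fn := [ffun=> c].

Lemma avg_const i c : avg i (const c) = const c.
Proof. by apply: avg_invariant => F v; rewrite !ffunE. Qed.

Lemma noise_const s c : noise s (const c) = const c.
Proof.
elim: s => //= i s ->; apply/ffunP => F.
by rewrite /damp avg_const !fnE ffunE; ring.
Qed.

Definition diagonal a b : Fn := [ffun F : Om => (F a == F b)%:R].

Lemma avg_diagonal a b : a != b -> avg a (diagonal a b) = const N^-1.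
Proof.
move=> ab; apply/ffunP => F; rewrite avgE !ffunE (bigD1 (F b)) //= big1 => [|v vF].
  by rewrite ffunE upd_same upd_other ?eqxx ?addr0 ?mulr1 // eq_sym.
by rewrite ffunE upd_same upd_other ?(negPf vF) // eq_sym.
Qed.

Lemma cross_diagonal a b : a != b -> cross a b (diagonal a b) = const N^-1.
Proof.
move=> ab; have avgb : avg b (diagonal a b) = const N^-1.
  rewrite -(@avg_diagonal b a); last by rewrite eq_sym.
  by congr (avg b _); apply/ffunP => F; rewrite !ffunE eq_sym.
by rewrite /cross avgb avg_diagonal // avg_const addrK.
Qed.

(** Self-adjointness moves the operators onto the indicator of the diagonal: [cross a b] makes it
    constant and [noise] fixes constants. *)
Lemma sum_planted_diag a b f : a != b ->
  \sum_(F : Om | F a == F b) (planted a b f F : R) = N^-1 * \sum_F (f F : R).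
Proof.
move=> ab; transitivity (dot (diagonal a b) (planted a b f)).
  rewrite big_mkcond; apply: eq_bigr => F _; rewrite [diagonal a b F]ffunE.
  by case: eqP; rewrite ?mul1r ?mul0r.
rewrite /planted noise_cross -dot_cross cross_diagonal // -dot_noise noise_const.
by rewrite /dot mulr_sumr; apply: eq_bigr => F _; rewrite ffunE.
Qed.

Lemma avg_le i f (c : R) : (forall F, (f F : R) <= c) -> forall F, (avg i f F : R) <= c.
Proof.
move=> fc F; rewrite avgE -[leRHS]mean_const ler_wpM2l ?invr_ge0 ?ler0n //.
exact: ler_sum.
Qed.

Lemma avg_ge0 i f : (forall F, 0 <= (f F : R)) -> forall F, 0 <= (avg i f F : R).
Proof. by move=> f0 F; rewrite avgE mulr_ge0 ?invr_ge0 ?ler0n ?sumr_ge0. Qed.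

Lemma noise_le s f (c : R) :
  (forall F, (f F : R) <= c) -> forall F, (noise s f F : R) <= c.
Proof.
move=> fc; elim: s => //= i s IH F; rewrite /damp fnD !fnZ.
have -> : c = r * c + (1 - r) * c by ring.
by rewrite lerD // ler_wpM2l ?subr_ge0 //; apply: avg_le.
Qed.

Lemma planted_le2 a b f : (forall F, 0 <= (f F : R) <= 1) ->
  forall F, (planted a b f F : R) <= 2.
Proof.
move=> f01; have f0 F : 0 <= (f F : R) by case/andP: (f01 F).
have f1 F : (f F : R) <= 1 by case/andP: (f01 F).
apply: noise_le => F; rewrite /cross !fnE.
have := avg_le a f1 F; have := avg_le b f1 F.
have := avg_ge0 a (avg_ge0 b f0) F; lra.
Qed.

Definition total : R := \sum_(F : Om) 1.

Lemma count_pair x y : x != y -> \sum_(F : Om) (F x == F y)%:R = N^-1 * total :> R.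
Proof.
move=> xy; rewrite -(sum_diag xy) // big_mkcond [RHS]big_mkcond.
by apply: eq_bigr => F _; case: eqP.
Qed.

(** Two different unordered pairs: one of [x], [y] lies outside [{a, b}], and resampling it makes
    the second collision independent of the first. *)
Lemma count_two_pairs a b x y : a != b -> x != y ->
  (x, y) != (a, b) -> (x, y) != (b, a) ->
  \sum_(F : Om | F a == F b) (F x == F y)%:R = N^-1 * (N^-1 * total) :> R.
Proof.
move=> ab xy n1 n2; rewrite -(count_pair ab).
have -> : \sum_(F : Om | F a == F b) (F x == F y)%:R =
    \sum_(F : Om | F x == F y) (F a == F b)%:R :> R.
  rewrite big_mkcond [RHS]big_mkcond; apply: eq_bigr => F _.
  by case: eqP; case: eqP.
have ind z : z != a -> z != b -> indep z (fun F : Om => (F a == F b)%:R).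
  by move=> za zb F v; rewrite !upd_other // eq_sym.
have [xa|xa] := eqVneq x a.
  apply: sum_diag_r => //; apply: ind; first by rewrite -xa eq_sym.
  by apply: contraNneq n1 => ->; rewrite xa.
have [xb|xb] := eqVneq x b; last by apply: sum_diag => //; apply: ind.
apply: sum_diag_r => //; apply: ind; last by rewrite -xb eq_sym.
by apply: contraNneq n2 => ->; rewrite xb.
Qed.

(** A collision is seen in both orders; this yields the division by 2 in the union bounds below. *)
Lemma collision_twice (P : pred (I * I)) (F : Om) x y :
  P (x, y) -> P (y, x) -> x != y -> F x = F y ->
  2 <= \sum_(p : I * I | P p) (F p.1 == F p.2)%:R :> R.
Proof.
move=> Pxy Pyx xy Fxy; rewrite (bigD1 (x, y)) //= (bigD1 (y, x)) /=; last first.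
  rewrite Pyx /=; apply: contra xy => /eqP[_ ->]; exact: eqxx.
rewrite Fxy eqxx addrA -[leLHS]addr0 lerD //.
by apply: sumr_ge0 => *; rewrite ler0n.
Qed.

Hypothesis V_large : 3 * #|I|%:R ^+ 2 <= N.

Lemma sum_pairs_le (P : pred (I * I)) (c : R) : 0 <= c ->
  \sum_(p : I * I | P p) (N^-1 * c) <= c / 3.
Proof.
move=> c0; have N0 : 0 < N by rewrite ltr0n.
apply: (@le_trans _ _ (\sum_(p : I * I) (N^-1 * c))).
  rewrite big_mkcond; apply: ler_sum => p _; case: ifP => // _.
  by rewrite mulr_ge0 // invr_ge0 ltW.
rewrite sumr_const card_prod -[leLHS]mulr_natl mulrA mulrC ler_wpM2l //.
by rewrite natrM ler_pdivrMr //; move: V_large; rewrite expr2; lra.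
Qed.

Hypothesis no_inj : forall F : Om, injective F -> no F.
Hypothesis yes_unique : forall a b (F : Om), X a -> ~~ X b -> F a = F b ->
  (forall x y, x != y -> F x = F y -> (x, y) = (a, b) \/ (x, y) = (b, a)) -> yes F.

Lemma total_ge0 : 0 <= total.
Proof. by apply: sumr_ge0 => *; rewrite ler01. Qed.

(** A union bound over ordered pairs gives [total / 3], halved since each collision is counted
    twice. *)
Lemma sum_not_no : \sum_(F : Om) (~~ no F)%:R <= total / 6.
Proof.
apply: (@le_trans _ _ (\sum_(F : Om)
   (\sum_(p : I * I | p.1 != p.2) (F p.1 == F p.2)%:R) / 2)).
  apply: ler_sum => F _; rewrite ler_pdivlMr //.
  case: (boolP (no F)) => [_|nno].
    by rewrite mul0r; apply: sumr_ge0 => *; rewrite ler0n.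
  have : ~~ injectiveb F by apply: contra nno => /injectiveP/no_inj.
  case/injectivePn => x [y xy Fxy]; rewrite mul1r.
  by apply: (collision_twice (x := x) (y := y)); rewrite //= eq_sym.
rewrite -mulr_suml exchange_big /=.
rewrite (eq_bigr (fun=> N^-1 * total)); last by move=> p; apply: count_pair.
have := sum_pairs_le (fun p => p.1 != p.2) total_ge0; lra.
Qed.

Lemma sum_diag_not_yes a b : X a -> ~~ X b ->
  \sum_(F : Om | F a == F b) (~~ yes F)%:R <= N^-1 * total / 6.
Proof.
move=> Xa Xb; have ab := cross_pair_neq Xa Xb.
pose P (p : I * I) := [&& p.1 != p.2, p != (a, b) & p != (b, a)].
apply: (@le_trans _ _ (\sum_(F : Om | F a == F b)
   (\sum_(p : I * I | P p) (F p.1 == F p.2)%:R) / 2)).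
  apply: ler_sum => F /eqP Fab; rewrite ler_pdivlMr //.
  case: (boolP (yes F)) => [_|nyes].
    by rewrite mul0r; apply: sumr_ge0 => *; rewrite ler0n.
  have [/existsP[[x y] /andP[/and3P[/= xy n1 n2] /eqP/= Fxy]]|] :=
      boolP [exists p : I * I, P p && (F p.1 == F p.2)].
    rewrite mul1r; apply: (collision_twice (x := x) (y := y)) => //.
      by rewrite /P /= xy n1.
    rewrite /P /= eq_sym xy /=; apply/andP; split.
      by apply: contra n2 => /eqP[-> ->].
    by apply: contra n1 => /eqP[-> ->].
  rewrite negb_exists => /forallP nex; case/negP: nyes.
  apply: (yes_unique Xa Xb Fab) => x y xy Fxy.
  have := nex (x, y); rewrite /P /= xy Fxy eqxx andbT /= negb_and !negbK.
  by case/orP => /eqP; [left|right].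
rewrite -mulr_suml exchange_big /=.
rewrite (eq_bigr (fun=> N^-1 * (N^-1 * total))); last first.
  by move=> [x y] /and3P[/= xy n1 n2]; apply: count_two_pairs.
have Nt : 0 <= N^-1 * total by rewrite mulr_ge0 ?total_ge0 // invr_ge0 ler0n.
have := sum_pairs_le P Nt; lra.
Qed.

(** For each pair, in units of [N^-1 * total]: the full diagonal carries at least 5/6, and inputs
    outside [yes] remove at most 2 * 1/6, as entries are at most 2 there. This leaves 1/2. *)
Lemma bform_planted_ge :
  #|X|%:R * #|predC X|%:R * (N^-1 * total) / 2 <=
  bform (kernel_of planted) (fun F => (yes F)%:R) (fun F => (no F)%:R).
Proof.
rewrite bform_kernel; last exact: planted_linear.
set h := [ffun F => _].
have h01 F : 0 <= (h F : R) <= 1 by rewrite ffunE; case: (no F); rewrite ?ler01 ?lexx.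
have -> : #|X|%:R * #|predC X|%:R * (N^-1 * total) / 2 =
    \sum_(a | X a) \sum_(b | ~~ X b) (N^-1 * total) / 2.
  rewrite !sumr_const -[RHS]mulr_natl -[X in _ = _ * X]mulr_natl; ring.
apply: ler_sum => a Xa; apply: ler_sum => b Xb.
have ab := cross_pair_neq Xa Xb.
have sp := sum_planted_diag h ab.
have sh : total - total / 6 <= \sum_F (h F : R).
  have -> : \sum_F (h F : R) = total - \sum_(F : Om) (~~ no F)%:R.
    rewrite -sumrB; apply: eq_bigr => F _; rewrite ffunE.
    by case: (no F); rewrite ?subr0 ?subrr.
  have := sum_not_no; lra.
have wle : \sum_(F : Om | F a == F b) (~~ yes F)%:R * (planted a b h F : R) <=
    2 * (N^-1 * total / 6).
  apply: (le_trans _ (ler_wpM2l _ (sum_diag_not_yes Xa Xb))) => //.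
  rewrite mulr_sumr; apply: ler_sum => F _; rewrite mulrC ler_wpM2r ?ler0n //.
  exact: planted_le2.
have -> : \sum_(F : Om | F a == F b) (yes F)%:R * (planted a b h F : R) =
    \sum_(F : Om | F a == F b) (planted a b h F : R) -
    \sum_(F : Om | F a == F b) (~~ yes F)%:R * (planted a b h F : R).
  rewrite -sumrB; apply: eq_bigr => F _.
  by case: (yes F); rewrite ?mul1r ?mul0r ?subr0 ?subrr.
rewrite sp; have N0 : 0 <= N^-1 by rewrite invr_ge0 ler0n.
have := ler_wpM2l N0 sh; lra.
Qed.

Lemma l2_yes_le :
  l2 (fun F : Om => (yes F)%:R : R) <= #|X|%:R * #|predC X|%:R * (N^-1 * total).
Proof.
have -> : #|X|%:R * #|predC X|%:R * (N^-1 * total) = crosssum (fun _ _ _ => 1).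
  have -> : crosssum (fun _ _ _ => 1) =
      \sum_(a | X a) \sum_(b | ~~ X b) (N^-1 * total).
    apply: eq_bigr => a Xa; apply: eq_bigr => b Xb.
    by rewrite sum_diag // cross_pair_neq.
  rewrite !sumr_const -[RHS]mulr_natl -[X in _ = _ * X]mulr_natl; ring.
rewrite crosssumE; apply: ler_sum => F _.
under eq_bigr do under eq_bigr do rewrite mulr1.
case: (boolP (yes F)) => [/yes_pair ->|_]; first by rewrite expr1n.
by rewrite expr0n; do 2 (apply: sumr_ge0 => ? _); rewrite ler0n.
Qed.

Lemma l2_no_le : l2 (fun F : Om => (no F)%:R : R) <= total.
Proof.
by apply: ler_sum => F _; case: (no F); rewrite ?expr1n ?expr0n ?ler01.
Qed.

End Averaging.

(** * List disjointness *)

Section ListDisjointness.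
Variables (D Rg : nat).
Implicit Types F : {ffun 'I_D -> 'I_Rg}.

Definition in_first_list : pred 'I_D := fun x => (x < D %/ 2)%N.

Lemma in_img0 F v :
  reflect (exists2 a, in_first_list a & v = F a) (v \in img0 F).
Proof.
apply: (iffP imsetP) => [[a]|[a Xa ->]]; first by rewrite inE => Xa ->; exists a.
by exists a; rewrite ?inE.
Qed.

Lemma in_img1 F v :
  reflect (exists2 b, ~~ in_first_list b & v = F b) (v \in img1 F).
Proof.
apply: (iffP imsetP) => [[b]|[b Xb ->]].
  by rewrite inE leqNgt => Xb ->; exists b.
by exists b; rewrite ?inE // leqNgt.
Qed.

Lemma halves_injectiveP F :
  reflect (forall x y, in_first_list x = in_first_list y -> F x = F y -> x = y)
          (halves_injective F).
Proof.
have E (x y : 'I_D) : (((x < D %/ 2) && (y < D %/ 2)) || ((D %/ 2 <= x) && (D %/ 2 <= y)))%N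
    = (in_first_list x == in_first_list y).
  by rewrite /in_first_list !(leqNgt (D %/ 2)); case: (x < _)%N; case: (y < _)%N.
apply: (iffP forallP) => [h x y xy Fxy|h x].
  by have /forallP/(_ y) := h x; rewrite E xy Fxy !eqxx => /eqP.
by apply/forallP => y; rewrite E; apply/implyP => /andP[/eqP xy /eqP Fxy]; apply/eqP/h.
Qed.

Lemma injective_no F : injective F -> LD1_instance F && ~~ LD1_language F.
Proof.
move=> inj; have hi : halves_injective F by apply/halves_injectiveP => x y _; apply: inj.
have i0 : img0 F :&: img1 F = set0.
  apply/setP => v; rewrite inE in_set0; apply/negP.
  case/andP => /in_img0[a Xa ->] /in_img1[b Xb /inj ab].
  by rewrite -ab Xa in Xb.
by rewrite /LD1_instance /LD1_language hi i0 cards0.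
Qed.

Lemma unique_collision_language a b F :
  in_first_list a -> ~~ in_first_list b -> F a = F b ->
  (forall x y, x != y -> F x = F y -> (x, y) = (a, b) \/ (x, y) = (b, a)) ->
  LD1_language F.
Proof.
move=> Xa Xb Fab uniq; apply/andP; split.
  apply/halves_injectiveP => x y xy Fxy; apply/eqP/negPn/negP => nxy.
  by case: (uniq x y nxy Fxy) => -[xE yE]; move: xy; rewrite xE yE Xa (negPf Xb).
suff -> : img0 F :&: img1 F = [set F a] by rewrite cards1.
apply/setP => v; rewrite in_set1 in_setI; apply/andP/eqP => [|->]; last first.
  by split; [apply/in_img0; exists a|apply/in_img1; exists b].
case=> /in_img0[x Xx ->] /in_img1[y Xy Fxy].
have nxy : x != y by apply: contraNneq Xy => <-.
by case: (uniq x y nxy Fxy) => -[xE yE]; rewrite xE.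
Qed.

(** Injectivity of each list makes the single common value determine both of its positions. *)
Lemma language_pair (R : realType) F : LD1_language F ->
  \sum_(a | in_first_list a) \sum_(b | ~~ in_first_list b) (F a == F b)%:R = 1 :> R.
Proof.
case/andP => /halves_injectiveP inj /cards1P[v imE].
have /setIP[/in_img0[a Xa va] /in_img1[b Xb vb]] : v \in img0 F :&: img1 F.
  by rewrite imE set11.
have coll x y : in_first_list x -> ~~ in_first_list y -> F x = F y -> x = a /\ y = b.
  move=> Xx Xy Fxy; have : F x \in img0 F :&: img1 F.
    by rewrite inE; apply/andP; split; [apply/in_img0; exists x|apply/in_img1; exists y].
  rewrite imE in_set1 => /eqP Fxv; split; apply: inj.
  - by rewrite Xx Xa.
  - by rewrite Fxv.
  - by rewrite (negPf Xy) (negPf Xb).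
  - by rewrite -Fxy Fxv.
rewrite (bigD1 a) //= (bigD1 b) //= -va -vb eqxx !big1 ?addr0 //.
  move=> x /andP[Xx nxa]; rewrite big1 // => y Xy; case: eqP => // Fxy.
  by case: (coll x y Xx Xy Fxy) nxa => ->; rewrite eqxx.
move=> y /andP[Xy nyb]; case: eqP => // vy.
by case: (coll a y Xa Xy (etrans (esym va) vy)) nyb => _ ->; rewrite eqxx.
Qed.

Lemma card_first_list : #|in_first_list| = (D %/ 2)%N.
Proof.
rewrite -sum1_card (eq_bigl (fun x : 'I_D => x < D %/ 2)%N) //.
rewrite (big_ord_narrow (leq_div D 2)) sum_nat_const card_ord muln1 //.
Qed.

Lemma card_second_list : (2 %| D)%N -> #|predC in_first_list| = (D %/ 2)%N.
Proof.
move=> ev; apply/eqP; rewrite -(eqn_add2l #|in_first_list|) cardC card_ord.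
by rewrite card_first_list -{1}(divnK ev) muln2 addnn.
Qed.

End ListDisjointness.

Lemma adv_1LD_adversary (R : realType) (D : nat) (A : qalg R D (3 * D ^ 2)) (k : R) :
  (2 %| D)%N -> (0 < D)%N -> 1 <= k -> k ^+ 3 = D%:R -> 0 <= adv_1LD A ->
  adv_1LD A ^+ 2 <= 32 * (qa_T A)%:R / k ^+ 2.
Proof.
move=> ev D_gt0 k_ge1 k3 adv_ge0.
have k_gt0 : 0 < k := lt_le_trans ltr01 k_ge1.
(* With [k] the cube root of [D], this sets [1 - r] to D^(-2/3) and [n] to the length D/2 of each
   list. *)
pose X := @in_first_list D; pose r := 1 - k ^- 2; pose n : R := k ^+ 3 / 2.
pose yes : pred {ffun 'I_D -> 'I_(3 * D ^ 2)} := @LD1_language _ _.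
pose no : pred {ffun 'I_D -> 'I_(3 * D ^ 2)} := fun F => LD1_instance F && ~~ LD1_language F.
have V_gt0 : (0 < #|'I_(3 * D ^ 2)|)%N by rewrite card_ord muln_gt0 expn_gt0 D_gt0.
have ke : 0 < k ^- 2 <= 1 by rewrite invr_gt0 exprn_gt0 //= invf_le1 ?exprn_gt0 // exprn_ege1.
have [r_ge0 r_lt1] : 0 <= r /\ r < 1 by rewrite /r; split; case/andP: ke; lra.
have nE : (D %/ 2)%:R = n.
  have -> : n = (D %/ 2 * 2)%:R / 2 by rewrite divnK // /n k3.
  by rewrite natrM mulfK // pnatr_eq0.
have cX : #|X|%:R = n by rewrite card_first_list.
have cY : #|predC X|%:R = n by rewrite card_second_list.
have n_gt0 : 0 < n by rewrite /n divr_gt0 ?exprn_gt0.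
set N := #|'I_(3 * D ^ 2)|%:R : R.
have N_gt0 : 0 < N by rewrite ltr0n.
set K := 2 * n ^+ 2 * (1 - r) ^+ 2 + (1 - r)^-1 + n * (1 - r) ^+ 2.
have K_le : K <= (2 * k) ^+ 2.
  have -> : K = k ^+ 2 / 2 + k ^+ 2 + k^-1 / 2.
    have e : 1 - r = k ^- 2 by rewrite /r opprB addrC subrK.
    by rewrite /K e /n invrK; field; rewrite gt_eqF.
  have : k^-1 <= 1 by rewrite invf_le1.
  have : 1 <= k ^+ 2 by rewrite exprn_ege1.
  rewrite exprMn; lra.
have V_large : 3 * #|'I_D|%:R ^+ 2 <= N by rewrite /N !card_ord natrM natrX.
set w : R := total R 'I_D 'I_(3 * D ^ 2).
have w_gt0 : 0 < w.
  rewrite /w /total sumr_const ltr0n; apply/card_gt0P.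
  by have /card_gt0P[v _] := V_gt0; exists [ffun=> v].
have low := bform_planted_ge V_gt0 r_ge0 r_lt1 V_large
  (@injective_no D _) (@unique_collision_language D _).
have y2 := l2_yes_le V_gt0 (@language_pair D _ R).
have n2 := l2_no_le R no.
rewrite -/N -/w cX cY in low y2.
have w' : 0 < n * n * (N^-1 * w) / 2 by rewrite !mulr_gt0 ?invr_gt0.
have van P : vanishes_off P (fun F : {ffun 'I_D -> 'I_(3 * D ^ 2)} => (P F)%:R : R).
  by move=> F /negPf ->.
have hx x g f : vanishes_off yes g -> vanishes_off no f ->
    `|bform (kernel_of X (nonlocal r x)) g f| <=
    Num.sqrt (N^-1 * K) * (Num.sqrt (l2 g) * Num.sqrt (l2 f)).
  move=> sg _; apply: (bform_nonlocal_le V_gt0 r_ge0 r_lt1 _ _ (@language_pair D _ R)) => //.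
  - by rewrite cX.
  - by rewrite cY.
have := general_adversary (A := A) (fun x F' F => @kernel_nonlocalE _ _ _ V_gt0 r X x F' F)
  (sqrtr_ge0 (N^-1 * K)) hx (van yes) (van no) (lt_le_trans w' low).
(* [p0] and [p1] are the two extrema in [adv_1LD], defaults included, so [p1 - p0] is the advantage
   itself. *)
move=> /(_ (\big[Order.max/0]_(F | no F) acc_prob A F)
           (\big[Order.min/1]_(F | yes F) acc_prob A F)).
rewrite -/(adv_1LD A) => adv.
have {}adv : adv_1LD A ^+ 2 * bform (kernel_of X (planted r))
     (fun F => (yes F)%:R) (fun F => (no F)%:R) <=
   4 * (qa_T A)%:R * Num.sqrt (N^-1 * K) *
   (Num.sqrt (l2 (fun F => (yes F)%:R)) * Num.sqrt (l2 (fun F => (no F)%:R))).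
  apply: adv => [F yF|F nF|]; first exact: bigmin_le_cond.
    exact: le_bigmax_cond.
  by rewrite -subr_ge0.
have S : Num.sqrt (N^-1 * K) *
   (Num.sqrt (l2 (fun F => (yes F)%:R : R)) * Num.sqrt (l2 (fun F => (no F)%:R : R)))
   <= N^-1 * w * n * (2 * k).
  have -> : N^-1 * w * n * (2 * k) =
      Num.sqrt (N^-1 * (2 * k) ^+ 2) * (Num.sqrt (n * n * (N^-1 * w)) * Num.sqrt w).
    have p1 : 0 <= n * n * (N^-1 * w) by rewrite ltW // !mulr_gt0 ?invr_gt0.
    have p2 : 0 <= N^-1 * (2 * k) ^+ 2 by rewrite mulr_ge0 ?sqr_ge0 // invr_ge0 ltW.
    rewrite -(sqrtrM _ p1) -(sqrtrM _ p2).
    rewrite [X in Num.sqrt X](_ : _ = (N^-1 * w * n * (2 * k)) ^+ 2); last by ring.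
    by rewrite sqrtr_sqr ger0_norm // ltW // !mulr_gt0 ?invr_gt0.
  apply: ler_pM; rewrite ?mulr_ge0 ?sqrtr_ge0 //.
    by apply: ler_wsqrtr; rewrite ler_wpM2l // invr_ge0 ltW.
  by apply: ler_pM; rewrite ?sqrtr_ge0 //; apply: ler_wsqrtr.
set T := (qa_T A)%:R : R in adv *.
have T0 : 0 <= T by rewrite ler0n.
have H1 := ler_wpM2l (sqr_ge0 (adv_1LD A)) low.
have H2 : 4 * T * Num.sqrt (N^-1 * K) *
   (Num.sqrt (l2 (fun F => (yes F)%:R : R)) * Num.sqrt (l2 (fun F => (no F)%:R : R)))
   <= 4 * T * (N^-1 * w * n * (2 * k)).
  by rewrite -mulrA; apply: ler_wpM2l; rewrite ?mulr_ge0.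
have {H1 H2} H := le_trans H1 (le_trans adv H2).
(* Since [k ^+ 3 = 2 * n], multiplying the goal by this factor turns its sides into the outer sides
   of [H]. *)
have c_gt0 : 0 < N^-1 * w * n * k / 4 by rewrite !mulr_gt0 ?invr_gt0.
rewrite ler_pdivlMr ?exprn_gt0 // -(ler_pM2l c_gt0).
apply: le_trans (le_trans H _); rewrite le_eqVlt; apply/orP; left; apply/eqP.
  by rewrite /n; field; rewrite gt_eqF.
by field; rewrite gt_eqF.
Qed.

(** * Logarithms and the final numerical estimate *)

Lemma le_lg (R : realType) (k : nat) (x : R) : 2 ^+ k <= x -> k%:R <= lg x.
Proof.
move=> kx; have ln2 : 0 < ln (2 : R) by rewrite ln_gt0 // ltr1n.
rewrite /lg ler_pdivlMr // mulr_natl -lnXn // ler_ln ?posrE ?exprn_gt0 //.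
by apply: lt_le_trans kx; rewrite exprn_gt0.
Qed.

Unset Implicit Arguments.

Theorem theorem6 (R : realType) (D q : nat) (A : qalg R D (3 * D ^ 2))
    (hD2 : exists k : nat, D = (2 ^ k)%N) (hD : (32 <= D)%N)
    (hq : (qa_T A <= q)%N) :
  adv_1LD A <=
  11 * powR ((q%:R * lg (D%:R : R) * lg (lg (D%:R : R))) ^+ 3 / (D%:R ^+ 2))
            (6%:R^-1).
Proof.
have [adv_le0|/ltW adv_ge0] := leP (adv_1LD A) 0.
  by apply: (le_trans adv_le0); rewrite mulr_ge0 ?powR_ge0.
have ev : (2 %| D)%N.
  by case: hD2 hD => -[|k] -> // _; rewrite expnS dvdn_mulr.
have D_gt0 : (0 < D)%N by apply: leq_trans hD.
pose k : R := powR D%:R 3^-1.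
have k3 : k ^+ 3 = D%:R.
  by rewrite -powR_mulrn ?powR_ge0 // -powRrM mulVf ?powRr1 ?ler0n // pnatr_eq0.
have k_ge0 : 0 <= k := powR_ge0 _ _.
have k_ge1 : 1 <= k.
  rewrite leNgt; apply/negP => k_lt1; have := exprn_ilt1 3 k_ge0 k_lt1.
  by rewrite k3 ltrn1 ltnNge D_gt0.
have k_gt0 : 0 < k := lt_le_trans ltr01 k_ge1.
have := adv_1LD_adversary ev D_gt0 k_ge1 k3 adv_ge0.
set d := adv_1LD A in adv_ge0 *; set T := (qa_T A)%:R : R => d2.
have lg5 : 5 <= lg (D%:R : R) by apply: (le_lg (k := 5)); rewrite -natrX ler_nat.
have lg2 : 2 <= lg (lg (D%:R : R)).
  by apply: (le_lg (k := 2)); apply: le_trans lg5; rewrite -natrX ler_nat.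
set z := q%:R * _ * _.
have T0 : 0 <= T by rewrite ler0n.
(* [D >= 32] gives [lg D >= 5] and [lg (lg D) >= 2], whence the factor 10. *)
have zT : 10 * T <= z.
  have Tq : T <= q%:R by rewrite ler_nat.
  have H1 : T * 5 <= q%:R * lg (D%:R : R) by apply: ler_pM.
  have -> : 10 * T = T * 5 * 2 by ring.
  by apply: ler_pM => //; rewrite mulr_ge0.
have z0 : 0 <= z by apply: le_trans zT; rewrite mulr_ge0.
move: z zT z0 => z zT z0; set y := powR _ _.
have y6 : y ^+ 6 = z ^+ 3 / k ^+ 6.
  rewrite -powR_mulrn ?powR_ge0 // -powRrM mulVf ?pnatr_eq0 // powRr1.
    by rewrite -k3 -exprM.
  by rewrite divr_ge0 ?exprn_ge0.
rewrite -(@ler_pXn2r _ 6) ?nnegrE ?mulr_ge0 ?powR_ge0 //.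
rewrite [leLHS](exprM d 2 3) [leRHS]exprMn y6.
apply: (@le_trans _ _ ((32 * T / k ^+ 2) ^+ 3)).
  by rewrite ler_pXn2r ?nnegrE ?sqr_ge0 // divr_ge0 ?mulr_ge0 ?sqr_ge0.
have -> : (32 * T / k ^+ 2) ^+ 3 = (32 * T) ^+ 3 / k ^+ 6.
  by rewrite expr_div_n -exprM.
rewrite mulrA ler_wpM2r ?invr_ge0 ?exprn_ge0 //.
rewrite [leRHS](_ : _ = (121 * z) ^+ 3); last first.
  by rewrite [RHS]exprMn; congr (_ * _); rewrite [LHS](exprM 11 2 3) -(natrX _ 11 2).
by rewrite ler_pXn2r ?nnegrE ?mulr_ge0 //; lra.
Qed.
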